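(* Under the change of variable $A=t^{-1/4}$, the polynomial $\mathcal{J}$ is a generalization of the Jones polynomial to tied links; that is, $\mathcal{J}$ becomes the one-variable Jones polynomial (in the variable $t$) on classical links, provided that they are considered as tied links whose components are all tied together.
   Context: $A,c$ are commuting independent variables. A tied link is a link together with a partition of the set of its components, depicted by ties; components in the same subset are said to be tied together; ''all tied together'' means the partition has a single class. A tied link diagram is a (nonempty) link diagram in $S^2$ together with a partition of the set of components. For an oriented tied link diagram $\overrightarrow{D}$ with associated unoriented diagram $D$ and writhe $w(D)$, $\mathcal{J}(\overrightarrow{D})=(-A)^{-3w(D)}\langle\langle D\rangle\rangle$. $\langle\langle\ \cdot\ \rangle\rangle$ is the unique function from unoriented tied link diagrams to $\mathbb{Z}[A^{\pm1},c]$ such that: (i) it is $1$ on the crossingless circle $O$; (ii) $\langle\langle O\sqcup D\rangle\rangle=c\langle\langle D\rangle\rangle$, where the added crossingless circle is not tied to $D$; (iii) $\langle\langle O\,\widetilde{\sqcup}\,D\rangle\rangle=-(A^2+A^{-2})\langle\langle D\rangle\rangle$, where the added crossingless circle is tied to a component of $D$; (iv) it is invariant under Reidemeister moves II and III (keeping the partition); (v) $\langle\langle D\rangle\rangle=A\langle\langle D_A\rangle\rangle+A^{-1}\langle\langle D_B\rangle\rangle$ for a crossing of $D$ whose strands belong to the same component or to components tied together, where $D_A,D_B$ are the $A$- and $B$-smoothings with a tie joining the two arcs; (vi) $\langle\langle D_+\rangle\rangle+\langle\langle D_-\rangle\rangle=(A+A^{-1})(\langle\langle D_e\rangle\rangle+\langle\langle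 D_f\rangle\rangle)$ for diagrams identical outside a disc and inside it equal to a crossing, the opposite crossing, and the two smoothings, each with a tie joining its two arcs. (A tie joining the two arcs of a smoothing puts all components through the disc, and all other components that before smoothing belonged to the classes of the strands at the crossing, into one class.) The $A$-smoothing joins the two regions swept out when the overcrossing strand is rotated counterclockwise onto the undercrossing strand. The Jones polynomial $V$ is normalized by $V(\text{unknot})=1$ and $t^{-1}V(L_+)-tV(L_-)=(t^{1/2}-t^{-1/2})V(L_0)$. *)

(* Defs.v *)
From HB Require Import structures.
From mathcomp Require Import all_boot all_order all_algebra.
From mathcomp Require Import boolp.

Set Implicit Arguments.
Unset Strict Implicit.
Unset Printing Implicit Defensive.
Import GRing.Theory.
Local Open Scope ring_scope.

Notation "x %:F" := (@tofrac _ x) : ring_scope.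

(** * Laurent polynomials [R[X, X^-1]] over an integral domain [R]:
    the fractions of the form [p / X^n]. *)

Definition laurent_repr (R : idomainType) (x : {fraction {poly R}})
    (pn : {poly R} * nat) : bool :=
  x == pn.1%:F / ('X ^+ pn.2)%:F.

Definition is_laurent (R : idomainType) : {pred {fraction {poly R}}} :=
  fun x => `[< exists pn, laurent_repr x pn >].

Section LaurentClosed.
Variable R : idomainType.

Lemma is_laurentP (x : {fraction {poly R}}) :
  reflect (exists pn, laurent_repr x pn) (x \in @is_laurent R).
Proof. exact: asboolP. Qed.

Lemma tofracXn_neq0 n : ('X ^+ n : {poly R})%:F != 0.
Proof. by rewrite tofrac_eq0 expf_neq0 // polyX_eq0. Qed.

Lemma is_laurent_subring : subring_closed (@is_laurent R).
Proof.
split.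
- by apply/is_laurentP; exists (1, 0%N); rewrite /laurent_repr /= expr0 tofrac1 divr1.
- move=> x y /is_laurentP[[p m] /eqP /= ->] /is_laurentP[[q n] /eqP /= ->].
  apply/is_laurentP; exists (p * 'X^n - q * 'X^m, (m + n)%N).
  rewrite /laurent_repr /= exprD tofracB !tofracM -mulNr.
  by rewrite addf_div ?tofracXn_neq0 // mulNr.
- move=> x y /is_laurentP[[p m] /eqP /= ->] /is_laurentP[[q n] /eqP /= ->].
  apply/is_laurentP; exists (p * q, (m + n)%N).
  by rewrite /laurent_repr /= exprD !tofracM mulf_div.
Qed.

HB.instance Definition _ :=
  GRing.isSubringClosed.Build {fraction {poly R}} (@is_laurent R) is_laurent_subring.

Record laurent := Laurent {
  laurent_val :> {fraction {poly R}};
  _ : laurent_val \in @is_laurent R }.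

HB.instance Definition _ := [isSub for laurent_val].
HB.instance Definition _ := [Choice of laurent by <:].
HB.instance Definition _ := [SubChoice_isSubComNzRing of laurent by <:].

Definition laurent_unit : {pred laurent} :=
  fun x => (x != 0) && ((val x)^-1 \in @is_laurent R).
Definition laurent_inv (x : laurent) : laurent :=
  if x \in laurent_unit then insubd x (val x)^-1 else x.

Lemma laurent_val_neq0 (x : laurent) : x != 0 -> val x != 0.
Proof. by apply: contraNneq => vx0; apply/eqP/val_inj; rewrite vx0 rmorph0. Qed.

Lemma laurent_mulVx : {in laurent_unit, left_inverse 1 laurent_inv *%R}.
Proof.
move=> x Ux; apply: val_inj; rewrite /laurent_inv Ux; case/andP: Ux => x0 Vx.
apply: etrans (rmorphM \val _ _) _; apply: etrans _ (esym (rmorph1 \val)).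
apply: etrans (congr1 (fun z => z * val x) (insubdK x Vx)) _.
exact/mulVf/laurent_val_neq0.
Qed.

Lemma laurent_unitP (x y : laurent) : y * x = 1 -> x \in laurent_unit.
Proof.
move=> yx; have yx1 : val y * val x = 1.
  apply: etrans (esym (rmorphM \val _ _)) _.
  exact: etrans (congr1 \val yx) (rmorph1 \val).
have vx0 : val x != 0.
  by apply: contra_eq_neq yx1 => ->; rewrite mulr0 eq_sym oner_neq0.
apply/andP; split; first by apply: contraNneq vx0 => ->; rewrite rmorph0.
by rewrite -[(val x)^-1]mul1r -yx1 mulfK ?(valP y).
Qed.

Lemma laurent_inv_out : {in [predC laurent_unit], laurent_inv =1 id}.
Proof. by move=> x /negbTE Ux; rewrite /laurent_inv Ux. Qed.

HB.instance Definition _ := GRing.ComNzRing_hasMulInverse.Build laurent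
  laurent_mulVx laurent_unitP laurent_inv_out.

Lemma poly_is_laurent (p : {poly R}) : p%:F \in @is_laurent R.
Proof.
by apply/is_laurentP; exists (p, 0%N); rewrite /laurent_repr /= expr0 tofrac1 divr1.
Qed.

Definition laurent_poly (p : {poly R}) : laurent := Laurent (poly_is_laurent p).

Definition laurentC (a : R) : laurent := laurent_poly a%:P.
Definition laurentX : laurent := laurent_poly 'X.

Lemma laurent_ex_repr (x : laurent) : exists pn, laurent_repr (val x) pn.
Proof. exact/is_laurentP/valP. Qed.

End LaurentClosed.

(** Substitution of the unit [u] for the variable, with coefficients mapped
    by [f]; any two representations [p / X^n] of [x] give the same value when
    [f] is a ring morphism and [u] is a unit. *)
Definition laurent_subst (R : idomainType) (S : comUnitRingType)
    (f : R -> S) (u : S) (x : laurent R) : S :=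
  let pn := xchoose (laurent_ex_repr x) in
  (map_poly f pn.1).[u] / u ^+ pn.2.

(** * Link diagrams

    A diagram is put in Morse position and read from bottom to top, as a
    word in cups, caps and crossings: in [(i, p)] the elementary piece [p] has
    exactly [i] strands on its left.  [Cross true] is the crossing whose
    over-strand goes from bottom left to top right.

    Strands carry colours in [C]. The two ends of a cup or of a cap carry dual
    colours, so that a colouring by [bool] with dual [negb] is an orientation
    ([true] pointing upwards), and a colouring with dual [id] is constant on
    each component. *)

Inductive piece (C : Type) := Cup of C | Cap | Cross of bool.
Arguments Cap {C}.
Arguments Cross {C} _.

Definition word (C : Type) := seq (nat * piece C).

Definition shift C (k : nat) (D : word C) : word C := [seq ((k + g.1)%N, g.2) | g <- D].

Definition map_piece C C' (f : C -> C') (p : piece C) : piece C' :=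
  match p with Cup c => Cup (f c) | Cap => Cap | Cross e => Cross e end.
Definition recolor C C' (f : C -> C') (D : word C) : word C' :=
  [seq (g.1, map_piece f g.2) | g <- D].

(** The colours of the cups; every component has at least one cup. *)
Definition colors C (D : word C) : seq C :=
  pmap (fun g => if g.2 is Cup c then Some c else None) D.

(** The strands above a piece, given those below; [None] if it does not fit. *)
Definition step (C : eqType) (dual : C -> C) (s : seq C) (g : nat * piece C) :
    option (seq C) :=
  match g.2, drop g.1 s with
  | Cup c, r =>
      if (g.1 <= size s)%N then Some (take g.1 s ++ [:: c, dual c & r]) else None
  | Cap, [:: a, b & r] => if b == dual a then Some (take g.1 s ++ r) else None
  | Cross _, [:: a, b & r] => Some (take g.1 s ++ [:: b, a & r])
  | _, _ => None
  end.

Fixpoint run (C : eqType) (dual : C -> C) (s : seq C) (D : word C) : option (seq C) :=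
  if D is g :: D' then obind (fun s' => run dual s' D') (step dual s g) else Some s.

Definition diagram (C : eqType) (dual : C -> C) (D : word C) : bool :=
  (0 < size D)%N && (run dual [::] D == Some [::]).

Definition legs_in C (p : piece C) : nat := if p is Cup _ then 0 else 2.
Definition legs_out C (p : piece C) : nat := if p is Cap then 0 else 2.

Section Moves.
Variables (C : eqType) (dual : C -> C).

(** Planar isotopy of diagrams in Morse position: exchange of the levels of
    distant pieces, cancellation of a minimum with a maximum, and a strand
    passing through an extremum of another strand that it crosses. *)
Inductive planar_move : word C -> word C -> Prop :=
| Level i k p q : planar_move
    [:: (i, p); ((i + legs_out p + k)%N, q)]
    [:: ((i + legs_in p + k)%N, q); (i, p)]
| SnakeL i c : planar_move [:: (i, Cup c); (i.+1, Cap)] [::]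
| SnakeR i c : planar_move [:: (i.+1, Cup c); (i, Cap)] [::]
| CupSlide i c e : planar_move
    [:: (i, Cup c); (i.+1, Cross e)] [:: (i.+1, Cup c); (i, Cross (~~ e))]
| CapSlide i e : planar_move
    [:: (i.+1, Cross e); (i, Cap)] [:: (i, Cross (~~ e)); (i.+1, Cap)].

Inductive reidemeister1 : word C -> word C -> Prop :=
| R1Cup i c e : reidemeister1 [:: (i, Cup c); (i, Cross e)] [:: (i, Cup (dual c))]
| R1Cap i e : reidemeister1 [:: (i, Cross e); (i, Cap)] [:: (i, Cap)].

Inductive reidemeister2 : word C -> word C -> Prop :=
| R2 i e : reidemeister2 [:: (i, Cross e); (i, Cross (~~ e))] [::].

(** The side condition rules out the cyclic pattern, in which no strand is
    above, or below, the two others. *)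
Inductive reidemeister3 : word C -> word C -> Prop :=
| R3 i a b c : (b == a) || (b == c) -> reidemeister3
    [:: (i, Cross a); (i.+1, Cross b); (i, Cross c)]
    [:: (i.+1, Cross c); (i, Cross b); (i.+1, Cross a)].

Inductive locally (R : word C -> word C -> Prop) : word C -> word C -> Prop :=
| Locally u l r v : R l r -> locally R (u ++ l ++ v) (u ++ r ++ v).

(** Isotopy across the point at infinity of the sphere: the diagram obtained
    from the long diagram [T] by closing its strand on the right, or on the left. *)
Inductive sphere_move : word C -> word C -> Prop :=
| SphereMove T c : run dual [:: c] T = Some [:: c] -> sphere_move
    ((0%N, Cup c) :: T ++ [:: (0%N, Cap)])
    ((0%N, Cup (dual c)) :: shift 1 T ++ [:: (0%N, Cap)]).

Definition isotopy (D D' : word C) : Prop :=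
  locally planar_move D D' \/ sphere_move D D'.

Definition invariant_under (T : Type) (f : word C -> T)
    (R : word C -> word C -> Prop) : Prop :=
  forall D D', diagram dual D -> diagram dual D' -> R D D' -> f D = f D'.

End Moves.

Definition circle C (c : C) : word C := [:: (0%N, Cup c); (0%N, Cap)].

(** * Tied links *)

(** The colour of a component is a name for its class; the names themselves
    are irrelevant, see [bracket_rename]. *)
Notation tied_word := (word nat) (only parsing).
Notation tied_diagram := (@diagram nat id).

(** The smoothing of a crossing of vertical strands of class [x] is either
    vertical or horizontal. *)
Definition vertical : tied_word := [::].
Definition horizontal (i x : nat) : tied_word := [:: (i, Cap); (i, Cup x)].

Definition smoothA (e : bool) (i x : nat) : tied_word :=
  if e then vertical else horizontal i x.
Definition smoothB (e : bool) (i x : nat) : tied_word :=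
  if e then horizontal i x else vertical.

Definition merge (x y z : nat) : nat := if z == y then x else z.

(** The ring [Z[A^{+-1}, c]]. *)
Definition ZAc : comUnitRingType := laurent {poly int}.
Definition varA : ZAc := laurentX {poly int}.
Definition varc : ZAc := laurentC 'X.

Record is_double_bracket (f : tied_word -> ZAc) : Prop := {
  bracket_isotopy : invariant_under id f (isotopy id);
  bracket_rename : forall (D : tied_word) (h : nat -> nat), tied_diagram D ->
    {in colors D &, injective h} -> f (recolor h D) = f D;
  bracket_circle : forall x, f (circle x) = 1;
  bracket_free_circle : forall u v i x,
    tied_diagram (u ++ v) -> tied_diagram (u ++ shift i (circle x) ++ v) ->
    x \notin colors (u ++ v) ->
    f (u ++ shift i (circle x) ++ v) = varc * f (u ++ v);
  bracket_tied_circle : forall u v i x,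
    tied_diagram (u ++ v) -> tied_diagram (u ++ shift i (circle x) ++ v) ->
    x \in colors (u ++ v) ->
    f (u ++ shift i (circle x) ++ v) = - (varA ^+ 2 + varA ^- 2) * f (u ++ v);
  bracket_R2 : invariant_under id f (locally (@reidemeister2 nat));
  bracket_R3 : invariant_under id f (locally (@reidemeister3 nat));
  bracket_smooth : forall u v e s1 s2 x,
    let i := size s1 in
    tied_diagram (u ++ (i, Cross e) :: v) ->
    run id [::] u = Some (s1 ++ [:: x, x & s2]) ->
    f (u ++ (i, Cross e) :: v) =
      varA * f (u ++ smoothA e i x ++ v) + varA^-1 * f (u ++ smoothB e i x ++ v);
  bracket_sum : forall u v s1 s2 x y,
    let i := size s1 in
    let u' := recolor (merge x y) u in
    let v' := recolor (merge x y) v in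
    tied_diagram (u ++ (i, Cross true) :: v) ->
    run id [::] u = Some (s1 ++ [:: x, y & s2]) ->
    f (u ++ (i, Cross true) :: v) + f (u ++ (i, Cross false) :: v) =
      (varA + varA^-1) * (f (u' ++ vertical ++ v') + f (u' ++ horizontal i x ++ v'))
}.

(** * Oriented diagrams *)

Notation oriented_word := (word bool) (only parsing).
Notation oriented_diagram := (@diagram bool negb).

(** The sign of the crossing [Cross e] of strands with directions [d], [d'];
    [true] means positive. *)
Definition crossing_sign (e d d' : bool) : bool := e == (d == d').

Fixpoint writhe_from (s : seq bool) (D : oriented_word) : int :=
  if D is g :: D' then
    (if g.2 is Cross e then
       if crossing_sign e (nth true s g.1) (nth true s g.1.+1) then 1 else -1
     else 0) + writhe_from (odflt [::] (step negb s g)) D'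
  else 0.
Definition writhe (D : oriented_word) : int := writhe_from [::] D.

(** The colour of a strand of an oriented tied diagram: direction and class. *)
Notation oriented_tied_word := (word (bool * nat)) (only parsing).
Definition reverse (x : bool * nat) : bool * nat := (~~ x.1, x.2).
Notation oriented_tied_diagram := (@diagram (bool * nat)%type reverse).

Definition forget_ties (D : oriented_tied_word) : oriented_word := recolor fst D.
Definition forget_orientation (D : oriented_tied_word) : tied_word := recolor snd D.

Definition all_tied (D : oriented_tied_word) : bool :=
  constant (colors (forget_orientation D)).

Definition calJ (f : tied_word -> ZAc) (D : oriented_tied_word) : ZAc :=
  (- varA) ^ (- 3 * writhe (forget_ties D)) * f (forget_orientation D).

(** * The Jones polynomial, in [Z[s^{+-1}]] where [s = t^{1/2}] *)

Definition Zs : comUnitRingType := laurent int.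
Definition sqrt_t : Zs := laurentX int.
Definition var_t : Zs := sqrt_t ^+ 2.

(** The oriented smoothing of a crossing whose lower ends have directions
    [d], [d']. *)
Definition oriented_smoothing (i : nat) (d d' : bool) : oriented_word :=
  if d == d' then [::] else [:: (i, Cap); (i, Cup d')].

Record is_jones (V : oriented_word -> Zs) : Prop := {
  jones_isotopy : invariant_under negb V (isotopy negb);
  jones_R1 : invariant_under negb V (locally (reidemeister1 negb));
  jones_R2 : invariant_under negb V (locally (@reidemeister2 bool));
  jones_R3 : invariant_under negb V (locally (@reidemeister3 bool));
  jones_unknot : forall d, V (circle d) = 1;
  jones_skein : forall u v s1 s2 d d',
    let i := size s1 in
    let Dp := u ++ (i, Cross (d == d')) :: v in
    let Dm := u ++ (i, Cross (d != d')) :: v in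
    let D0 := u ++ oriented_smoothing i d d' ++ v in
    oriented_diagram Dp -> run negb [::] u = Some (s1 ++ [:: d, d' & s2]) ->
    var_t^-1 * V Dp - var_t * V Dm = (sqrt_t - sqrt_t^-1) * V D0
}.

(** * The change of variable, in [Z[q^{+-1}, c]] where [q = t^{1/4}] *)

Definition Zqc : comUnitRingType := laurent {poly int}.
Definition root4_t : Zqc := laurentX {poly int}.

(** [A = q^-1], and [c] is kept. *)
Definition subst_A (x : ZAc) : Zqc := laurent_subst (@laurentC {poly int}) root4_t^-1 x.
(** [s = q^2]. *)
Definition subst_s (x : Zs) : Zqc :=
  laurent_subst (fun n : int => n%:~R : Zqc) (root4_t ^+ 2) x.

(* Main.v *)
Require Import Defs.
From HB Require Import structures.
From mathcomp Require Import all_boot all_order all_algebra.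
From mathcomp Require Import ring zify.
From Corelib Require Import Setoid Morphisms.

(** A function of oriented diagrams that is invariant under planar isotopy and
    the Reidemeister moves and satisfies the skein relation of the Jones
    polynomial is determined by its value on the circle. To see this, read a
    diagram from bottom to top: modulo the skein relation every initial part of
    it is a combination of layered tangles, in which each arc starts at the far
    left and passes over all the earlier arcs. Indeed, a layered tangle followed
    by a cup, a cap or a crossing is again such a combination, because pieces
    slide below the top arc, the skein relation gives the sign of a crossing for
    free, and two top arcs exchange their levels when their left ends cross.
    The closed layered tangle is empty, so two skein invariants that agree on
    the circle agree everywhere.

    On diagrams with a single class the double bracket obeys Kauffman's relations:
    [A], [A^-1] smoothings, and a factor [-(A^2 + A^-2)] for each circle. Hence
    [calJ] is invariant under the first Reidemeister move as well and
    satisfies the Jones skein relation for [t^(1/2) = A^-2]. *)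

Set Implicit Arguments.
Unset Strict Implicit.
Unset Printing Implicit Defensive.
Import GRing.Theory.
Local Open Scope ring_scope.

(** * Words in cups, caps and crossings *)

Section Words.
Variables (C : eqType) (dual : C -> C).
Implicit Types (s : seq C) (l r u v D : word C) (p q : piece C).

Lemma run_cat s u v : run dual s (u ++ v) = obind (run dual ^~ v) (run dual s u).
Proof. by elim: u s => //= g u IHu s; case: step. Qed.

Lemma step_cat s1 s2 i p :
  step dual (s1 ++ s2) ((size s1 + i)%N, p) = omap (cat s1) (step dual s2 (i, p)).
Proof.
rewrite /step /= drop_cat take_cat ltnNge leq_addr addKn /= size_cat leq_add2l.
case: p => [c||e]; first by case: ifP => // _; rewrite -catA.
- by case: (drop i s2) => [|a [|b r]] //; case: ifP => // _; rewrite -catA.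
- by case: (drop i s2) => [|a [|b r]] //; rewrite /= -catA.
Qed.

Lemma step_short s i p : (size s < i)%N -> step dual s (i, p) = None.
Proof.
by move=> lt_s_i; rewrite /step /= leqNgt lt_s_i drop_oversize ?(ltnW lt_s_i) //; case: p.
Qed.

Lemma run_shift s1 s2 D :
  run dual (s1 ++ s2) (shift (size s1) D) = omap (cat s1) (run dual s2 D).
Proof.
elim: D s2 => //= -[i p] D IHD s2; rewrite step_cat.
by case: step => //= s'; rewrite IHD.
Qed.

(** One-sided because the short side of a Reidemeister II or snake move is the empty word, which
    fits any strands, whereas the long side needs strands at its place. *)
Definition run_le l r := forall s s', run dual s l = Some s' -> run dual s r = Some s'.

Lemma run_shift_short s i D :
  (0 < size D)%N -> (size s < i)%N -> run dual s (shift i D) = None.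
Proof. by case: D => // -[k p] D _ lt_s_i /=; rewrite step_short // ltn_addr. Qed.

Lemma run_shift_drop s i D : (i <= size s)%N ->
  run dual s (shift i D) = omap (cat (take i s)) (run dual (drop i s) D).
Proof.
move=> le_i_s.
by rewrite -[X in shift X D](size_takel le_i_s) -run_shift cat_take_drop.
Qed.

(** Reduces a check at height [i] to [i = 0]. A nonempty shifted word fails on fewer than [i]
    strands, whereas an empty one would not, hence the two size conditions. *)
Lemma run_shift_eq i l r : (0 < size l)%N -> (0 < size r)%N ->
  (forall s, run dual s l = run dual s r) ->
  forall s, run dual s (shift i l) = run dual s (shift i r).
Proof.
move=> l0 r0 lr s; have [le_i_s|lt_s_i] := leqP i (size s).
  by rewrite !run_shift_drop ?lr.
by rewrite !run_shift_short.
Qed.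

Lemma run_le_shift i l r : (0 < size l)%N -> run_le l r -> run_le (shift i l) (shift i r).
Proof.
move=> l0 le_lr s s'; have [le_i_s|lt_s_i] := leqP i (size s).
  rewrite !run_shift_drop //.
  by case El: run => [t|] //= [<-]; rewrite (le_lr _ _ El).
by rewrite run_shift_short.
Qed.

Lemma step_size s s' g :
  step dual s g = Some s' ->
  ((g.1 + legs_in g.2 <= size s) && (size s' + legs_in g.2 == size s + legs_out g.2))%N.
Proof.
case: g => i p; rewrite /step /=.
have [le_i_s|lt_s_i] := leqP i (size s); last first.
  by rewrite drop_oversize ?(ltnW lt_s_i) //; case: p.
have := size_drop i s; case: p => [c||e] /=.
- by move=> Hs [<-]; rewrite size_cat size_takel //= Hs; lia.
- case: (drop i s) => [|a [|b t]] //= Hs; case: ifP => // _ [<-].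
  by rewrite size_cat size_takel //; lia.
- case: (drop i s) => [|a [|b t]] //= Hs [<-].
  by rewrite size_cat size_takel //=; lia.
Qed.


Lemma run_size s s' u g : run dual s (u ++ [:: g]) = Some s' ->
  (g.1 + legs_out g.2 <= size s')%N.
Proof.
rewrite run_cat; case: run => //= t; case Eg: step => [t'|] //= [<-].
have /andP[? /eqP ?] := step_size Eg; lia.
Qed.

Hypothesis dualK : involutive dual.

Lemma eq_dualC a b : (b == dual a) = (a == dual b).
Proof. by rewrite -(inj_eq (can_inj dualK)) dualK eq_sym. Qed.

Lemma step_Cup0 s c : step dual s (0%N, Cup c) = Some [:: c, dual c & s].
Proof. by rewrite /step /= take0 drop0. Qed.

Lemma step_Cap0 s a b :
  step dual [:: a, b & s] (0%N, Cap) = if b == dual a then Some s else None.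
Proof. by []. Qed.

Lemma step_Cross0 s a b e : step dual [:: a, b & s] (0%N, Cross e) = Some [:: b, a & s].
Proof. by []. Qed.

Lemma run_Level i k p q s :
  run dual s [:: (i, p); ((i + legs_out p + k)%N, q)] =
  run dual s [:: ((i + legs_in p + k)%N, q); (i, p)].
Proof.
have := @run_shift_eq i [:: (0%N, p); ((legs_out p + k)%N, q)]
  [:: ((legs_in p + k)%N, q); (0%N, p)] isT isT _ s.
rewrite /= !addnA !addn0; apply=> {}s.
have stepC a b t k' q' :
  step dual (a :: b :: t) (k'.+2, q') = omap (cat [:: a; b]) (step dual t (k', q')).
  exact: (step_cat [:: a; b]).
rewrite /=; case: p => [c||e]; rewrite ?add0n.
- rewrite step_Cup0 /= stepC; case: step => //= t.
  by rewrite take0 drop0.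
- case: s => [|a [|b s]]; rewrite ?stepC ?[X in _ = obind _ X]step_short //.
  rewrite step_Cap0; case: ifP => Hb /=; case: (step dual s (k, q)) => [t|] //;
    by rewrite /= /step /= Hb.
- case: s => [|a [|b s]]; rewrite ?stepC ?[X in _ = obind _ X]step_short //.
  by rewrite step_Cross0 /= stepC; case: step.
Qed.

Lemma run_CupSlide i c e s :
  run dual s [:: (i, Cup c); (i.+1, Cross e)] =
  run dual s [:: (i.+1, Cup c); (i, Cross (~~ e))].
Proof.
have := @run_shift_eq i [:: (0%N, Cup c); (1%N, Cross e)]
  [:: (1%N, Cup c); (0%N, Cross (~~ e))] isT isT _ s.
rewrite /= addn0 addn1; apply => {}s.
by rewrite /step /= drop0 take0; case: s => //= x s; rewrite !take0 !drop0.
Qed.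

Lemma run_CapSlide i e s :
  run dual s [:: (i.+1, Cross e); (i, Cap)] =
  run dual s [:: (i, Cross (~~ e)); (i.+1, Cap)].
Proof.
have := @run_shift_eq i [:: (1%N, Cross e); (0%N, Cap)]
  [:: (0%N, Cross (~~ e)); (1%N, Cap)] isT isT _ s.
rewrite /= addn0 addn1; apply => {}s.
by rewrite /step /=; case: s => //= x [|y [|z s]].
Qed.

Lemma run_R1Cup i c e s :
  run dual s [:: (i, Cup c); (i, Cross e)] = run dual s [:: (i, Cup (dual c))].
Proof.
have := @run_shift_eq i [:: (0%N, Cup c); (0%N, Cross e)]
  [:: (0%N, Cup (dual c))] isT isT _ s.
by rewrite /= addn0; apply => {}s; rewrite /step /= drop0 take0 dualK.
Qed.

Lemma run_R1Cap i e s :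
  run dual s [:: (i, Cross e); (i, Cap)] = run dual s [:: (i, Cap)].
Proof.
have := @run_shift_eq i [:: (0%N, Cross e); (0%N, Cap)] [:: (0%N, Cap)] isT isT _ s.
rewrite /= addn0; apply => {}s.
rewrite /step /= drop0; case: s => [|x [|y s]] //=.
by rewrite eq_dualC.
Qed.

Lemma run_R3 i a b c s :
  run dual s [:: (i, Cross a); (i.+1, Cross b); (i, Cross c)] =
  run dual s [:: (i.+1, Cross c); (i, Cross b); (i.+1, Cross a)].
Proof.
have := @run_shift_eq i [:: (0%N, Cross a); (1%N, Cross b); (0%N, Cross c)]
   [:: (1%N, Cross c); (0%N, Cross b); (1%N, Cross a)] isT isT _ s.
rewrite /= addn0 addn1; apply => {}s.
by rewrite /step /= drop0; case: s => [|x [|y [|z s]]].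
Qed.

Lemma run_R2 i e e' s : (i.+1 < size s)%N ->
  run dual s [:: (i, Cross e); (i, Cross e')] = Some s.
Proof.
move=> lt_i_s; have le_i_s := ltnW (ltnW lt_i_s).
have := @run_shift_drop s i [:: (0%N, Cross e); (0%N, Cross e')] le_i_s.
rewrite /= addn0 => ->; rewrite /step /= !drop0.
have := size_drop i s; case E: (drop i s) => [|x [|y t]]; rewrite /= ?take0 ?drop0 /=; try lia.
by rewrite -E cat_take_drop.
Qed.

Lemma run_le_R2 i e e' : run_le [:: (i, Cross e); (i, Cross e')] [::].
Proof.
move=> s s' E; rewrite -E run_R2 //; move: E => /=.
by case E: step => [t|] //; have /andP[] := step_size E; rewrite /=; lia.
Qed.

Lemma run_le_SnakeL i c : run_le [:: (i, Cup c); (i.+1, Cap)] [::].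
Proof.
have := @run_le_shift i [:: (0%N, Cup c); (1%N, Cap)] [::] isT.
rewrite /= addn0 addn1; apply => s s'.
rewrite /= /step /= take0 drop0; case: s => //= x s.
by rewrite dualK; case: eqP => //= -> <-.
Qed.

Lemma run_le_SnakeR i c : run_le [:: (i.+1, Cup c); (i, Cap)] [::].
Proof.
have := @run_le_shift i [:: (1%N, Cup c); (0%N, Cap)] [::] isT.
rewrite /= addn0 addn1; apply => s s'.
rewrite /= /step /=; case: s => //= x s.
by rewrite !take0 !drop0 /=; case: eqP => //= ->; rewrite dualK.
Qed.

Lemma step_nil g s' : step dual [::] g = Some s' ->
  exists2 c, g = (0%N, Cup c) & s' = [:: c; dual c].
Proof.
case: g => i p; rewrite /step /=; case: p => [c||e] //=.
by case: i => //= -[<-]; exists c.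
Qed.

End Words.

(** * Uniqueness of skein invariants *)

(** The ring and the square root [s] of the variable are parameters, so that both sides of the final
    equality can be carried into [Zqc], with [s] the square of [root4_t]. *)
Record skein_invariant (K : comUnitRingType) (s : K) (f : word bool -> K) : Prop := {
  skein_planar : invariant_under negb f (locally (@planar_move bool));
  skein_R1 : invariant_under negb f (locally (reidemeister1 negb));
  skein_R2 : invariant_under negb f (locally (@reidemeister2 bool));
  skein_R3 : invariant_under negb f (locally (@reidemeister3 bool));
  skein_rel : forall u v s1 s2 d d',
    let i := size s1 in
    oriented_diagram (u ++ (i, Cross (d == d')) :: v) ->
    run negb [::] u = Some (s1 ++ [:: d, d' & s2]) ->
    (s ^+ 2)^-1 * f (u ++ (i, Cross (d == d')) :: v)
      - s ^+ 2 * f (u ++ (i, Cross (d != d')) :: v) =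
    (s - s^-1) * f (u ++ oriented_smoothing i d d' ++ v)
}.

(* The strand starting at [i] crosses over the next [n] strands. *)
Definition over (i n : nat) : word bool := [seq (k, Cross true) | k <- iota i n].

Arguments over : simpl never.

(** The left end stays at position 0; the right leg passes over [n] strands and ends at position
    [n.+1]. All case distinctions on the place of a piece refer to these two ends. *)
Definition arc (c : bool) (n : nat) : word bool := (0%N, Cup c) :: over 1 n.

Lemma over_cat i m n : over i (m + n) = over i m ++ over (i + m) n.
Proof. by rewrite /over iotaD map_cat. Qed.

Lemma arcS c n : arc c n.+1 = arc c n ++ [:: (n.+1, Cross true)].
Proof. by rewrite /arc -(addn1 n) over_cat add1n addn1. Qed.

(* [m] arcs in layers: each new arc starts at the far left and runs above
   all the previous ones. *)
Inductive layered : nat -> word bool -> Prop :=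
| layered0 : layered 0 [::]
| layeredS m w c n : layered m w -> layered m.+1 (w ++ arc c n).

Lemma diagram_run (u x v : word bool) : oriented_diagram (u ++ x ++ v) ->
  exists t t', [/\ run negb [::] u = Some t, run negb t x = Some t' &
    run negb t' v = Some [::]].
Proof.
case/andP=> _; rewrite run_cat; case: run => [t|] //=.
by rewrite run_cat; case Ex: run => [t'|] //= /eqP; exists t, t'.
Qed.

Lemma diagram_replace (u x y v : word bool) t t' : run negb [::] u = Some t ->
  run negb t x = Some t' -> run negb t y = Some t' -> (0 < size (u ++ y ++ v))%N ->
  oriented_diagram (u ++ x ++ v) -> oriented_diagram (u ++ y ++ v).
Proof.
move=> Eu Ex Ey nz /andP[_]; rewrite /diagram nz !run_cat Eu /= !run_cat Ex Ey.
by [].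
Qed.

Lemma size_split (t : seq bool) i : (i.+1 < size t)%N ->
  exists t1 d d' t2, t = t1 ++ [:: d, d' & t2] /\ size t1 = i.
Proof.
move=> lt_i_t; exists (take i t), (nth true t i), (nth true t i.+1), (drop i.+2 t).
by rewrite -!drop_nth ?cat_take_drop ?size_takel //; lia.
Qed.

Lemma run_Cross_at t1 d d' t2 e :
  run negb (t1 ++ [:: d, d' & t2]) [:: (size t1, Cross e)] = Some (t1 ++ [:: d', d & t2]).
Proof.
have := run_shift negb t1 [:: d, d' & t2] [:: (0%N, Cross e)].
by rewrite /= addn0 => ->.
Qed.

Lemma run_smoothing_at t1 d d' t2 :
  run negb (t1 ++ [:: d, d' & t2]) (oriented_smoothing (size t1) d d') =
    Some (t1 ++ [:: d', d & t2]).
Proof.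
rewrite /oriented_smoothing; case: eqP => [->|] // dd'.
have := run_shift negb t1 [:: d, d' & t2] [:: (0%N, Cap); (0%N, Cup d')].
rewrite /= addn0 => ->; rewrite step_Cap0.
by case: d d' dd' => [] [] // _; rewrite /= /step /= take0 drop0.
Qed.

Lemma run_arc (u : word bool) c n t : run negb [::] (u ++ arc c n) = Some t -> (n.+1 < size t)%N.
Proof.
case: n => [|n]; first by move/run_size.
by rewrite arcS catA => /run_size; rewrite addn2.
Qed.

Section Uniqueness.
Variables (K : comUnitRingType) (s : K) (f g : word bool -> K).
Hypotheses (f_skein : skein_invariant s f) (g_skein : skein_invariant s g).
Hypothesis s_unit : s \is a GRing.unit.
Hypothesis s_reg : forall x, (s - s^-1) * x = 0 -> x = 0.
Hypothesis fg_circle : forall d, f (circle d) = g (circle d).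

Implicit Types (l r u v w D : word bool).

(** Holds vacuously for words that are not diagrams, so that ill-formed intermediate words need no
    separate treatment. *)
Definition agree D := oriented_diagram D -> f D = g D.

(** Quantifying over contexts makes the relation compatible with concatenation. It has a direction
    because the reverse of a move such as Reidemeister II may turn a diagram into a word that does
    not fit, for which agreement says nothing. *)
Variant reduces l r : Prop :=
  Reduces of forall u v, agree (u ++ r ++ v) -> agree (u ++ l ++ v).
Definition equiv l r := reduces l r /\ reduces r l.

Lemma reduces_refl : Reflexive reduces. Proof. by move=> x; split. Qed.
Lemma reduces_trans : Transitive reduces.
Proof. by move=> x y z [xy] [yz]; split=> u v /yz/xy. Qed.
#[local] Instance reduces_preorder : PreOrder reduces.
Proof. by split; [apply: reduces_refl | apply: reduces_trans]. Qed.
#[local] Instance equiv_equivalence : Equivalence equiv.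
Proof.
split; first by move=> x; split.
- by move=> x y [].
- by move=> x y z [xy yx] [yz zy]; split; [transitivity y | transitivity y].
Qed.
#[local] Hint Resolve reduces_refl : core.
#[local] Instance cat_reduces : Proper (reduces ==> reduces ==> reduces) (@cat (nat * piece bool)).
Proof.
move=> x y [xy] z t [zt]; split=> u v; rewrite -!catA => /xy; rewrite catA => /zt.
by rewrite -catA.
Qed.
#[local] Instance cat_equiv : Proper (equiv ==> equiv ==> equiv) (@cat (nat * piece bool)).
Proof. by move=> x y [xy yx] z t [zt tz]; split; apply: cat_reduces. Qed.
#[local] Instance equiv_reduces : subrelation equiv reduces.
Proof. by move=> x y []. Qed.
#[local] Instance cons_equiv : Proper (eq ==> equiv ==> equiv) (@cons (nat * piece bool)).
Proof. by move=> x _ <- z t zt; apply: (@cat_equiv [:: x] [:: x] _ z t zt); split. Qed.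

(** * Moves as rewriting rules *)

Definition move_inv l r := forall u v,
  oriented_diagram (u ++ l ++ v) -> oriented_diagram (u ++ r ++ v) ->
  f (u ++ l ++ v) = f (u ++ r ++ v) /\ g (u ++ l ++ v) = g (u ++ r ++ v).

Lemma move_inv_sym l r : move_inv l r -> move_inv r l.
Proof. by move=> lr u v dr dl; have [-> ->] := lr u v dl dr. Qed.

(** The last hypothesis excludes that a diagram becomes the empty word, which is not a diagram: this
    could only happen with an empty context, where [l] would have to run from no strands. *)
Lemma reducesP l r : move_inv l r -> run_le negb l r ->
  (0 < size r)%N || (run negb [::] l == None) -> reduces l r.
Proof.
move=> inv le_lr nz; split=> u v agr dl.
have dr : oriented_diagram (u ++ r ++ v).
  case/andP: dl => _ /eqP; rewrite !run_cat.
  case Eu: (run negb [::] u) => [t|] //=.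
  rewrite run_cat; case El: (run negb t l) => [t'|] //= Ev.
  rewrite /diagram !run_cat Eu /= run_cat (le_lr _ _ El) /= Ev eqxx andbT.
  case/orP: nz => [|/eqP l0]; first by rewrite !size_cat; lia.
  case: u Eu {agr} => // -[Et]; case: v {Ev} => [|? ?]; last by rewrite !size_cat /=; lia.
  by rewrite -Et l0 in El.
by have [-> ->] := inv u v dl dr; apply: agr.
Qed.

Lemma equivP l r : move_inv l r -> (forall s, run negb s l = run negb s r) ->
  (0 < size l)%N -> (0 < size r)%N -> equiv l r.
Proof.
move=> inv eq_run l0 r0; split; apply: reducesP => //; rewrite ?l0 ?r0 //.
- by move=> t t'; rewrite eq_run.
- exact: move_inv_sym.
- by move=> t t'; rewrite eq_run.
Qed.

Lemma planar_inv l r : planar_move l r -> move_inv l r.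
Proof.
move=> lr u v dl dr; split.
- exact: (skein_planar f_skein dl dr (Locally _ _ lr)).
- exact: (skein_planar g_skein dl dr (Locally _ _ lr)).
Qed.
Lemma R1_inv l r : reidemeister1 negb l r -> move_inv l r.
Proof.
move=> lr u v dl dr; split.
- exact: (skein_R1 f_skein dl dr (Locally _ _ lr)).
- exact: (skein_R1 g_skein dl dr (Locally _ _ lr)).
Qed.
Lemma R2_inv l r : reidemeister2 l r -> move_inv l r.
Proof.
move=> lr u v dl dr; split.
- exact: (skein_R2 f_skein dl dr (Locally _ _ lr)).
- exact: (skein_R2 g_skein dl dr (Locally _ _ lr)).
Qed.
Lemma R3_inv l r : reidemeister3 l r -> move_inv l r.
Proof.
move=> lr u v dl dr; split.
- exact: (skein_R3 f_skein dl dr (Locally _ _ lr)).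
- exact: (skein_R3 g_skein dl dr (Locally _ _ lr)).
Qed.

Lemma equiv_Level i k p q : equiv
  [:: (i, p); ((i + legs_out p + k)%N, q)] [:: ((i + legs_in p + k)%N, q); (i, p)].
Proof. by apply: equivP => //; [apply/planar_inv/Level | apply: run_Level]. Qed.

Lemma equiv_CupSlide i c e : equiv
  [:: (i, Cup c); (i.+1, Cross e)] [:: (i.+1, Cup c); (i, Cross (~~ e))].
Proof. by apply: equivP => //; [apply/planar_inv/CupSlide | apply: run_CupSlide]. Qed.

Lemma equiv_CapSlide i e : equiv
  [:: (i.+1, Cross e); (i, Cap)] [:: (i, Cross (~~ e)); (i.+1, Cap)].
Proof. by apply: equivP => //; [apply/planar_inv/CapSlide | apply: run_CapSlide]. Qed.

Lemma equiv_R1Cup i c e : equiv [:: (i, Cup c); (i, Cross e)] [:: (i, Cup (~~ c))].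
Proof. by apply: equivP => //; [apply/R1_inv/R1Cup | apply/run_R1Cup/negbK]. Qed.

Lemma equiv_R1Cap i e : equiv [:: (i, Cross e); (i, Cap)] [:: (i, Cap)].
Proof. by apply: equivP => //; [apply/R1_inv/R1Cap | apply/run_R1Cap/negbK]. Qed.

Lemma equiv_R3 i a b c : (b == a) || (b == c) -> equiv
  [:: (i, Cross a); (i.+1, Cross b); (i, Cross c)]
  [:: (i.+1, Cross c); (i, Cross b); (i.+1, Cross a)].
Proof. by move=> abc; apply: equivP => //; [apply/R3_inv/R3 | apply/run_R3]. Qed.

Lemma reduces_R2 i e : reduces [:: (i, Cross e); (i, Cross (~~ e))] [::].
Proof.
apply: reducesP; [exact/R2_inv/R2 | exact/run_le_R2 |].
by case: i.
Qed.

Lemma reduces_SnakeL i c : reduces [:: (i, Cup c); (i.+1, Cap)] [::].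
Proof.
apply: reducesP; [exact/planar_inv/SnakeL | exact/run_le_SnakeL/negbK |].
by case: i.
Qed.

Lemma reduces_SnakeR i c : reduces [:: (i.+1, Cup c); (i, Cap)] [::].
Proof.
apply: reducesP; [exact/planar_inv/SnakeR | exact/run_le_SnakeR/negbK |].
by case: i.
Qed.

(* The converse of [reduces_R2] needs the two strands to exist. *)
Lemma agree_R2 u v i e t : run negb [::] u = Some t -> (i.+1 < size t)%N ->
  agree (u ++ [:: (i, Cross e); (i, Cross (~~ e))] ++ v) -> agree (u ++ v).
Proof.
move=> Eu lt_i_t agr du.
have dl : oriented_diagram (u ++ [:: (i, Cross e); (i, Cross (~~ e))] ++ v).
  case/andP: du => _ /eqP; rewrite run_cat Eu /= => Ev.
  apply/andP; split; first by rewrite !size_cat /=; lia.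
  rewrite run_cat Eu /=; have := run_R2 negb e (~~ e) lt_i_t.
  by rewrite /=; case: step => //= t1; case: step => //= t2 [->]; rewrite Ev.
have [<- <-] := R2_inv (R2 _ i e) dl du; exact: agr.
Qed.

(** * Sliding pieces past the top arc *)

Lemma over_far i n k q : (i + n < k)%N -> equiv (over i n ++ [:: (k, q)]) ((k, q) :: over i n).
Proof.
elim: n i => [|n IHn] i lt_in_k; first by split.
rewrite -[over i n.+1]/((i, Cross true) :: over i.+1 n) cat_cons IHn; last by lia.
have -> : k = (i + 2 + (k - (i + 2)))%N by lia.
exact: (cat_equiv (equiv_Level i (k - (i + 2)) (Cross true) q) (reflexivity (over i.+1 n))).
Qed.

Lemma piece_over k q d n : equiv
  ((k, q) :: over (k + legs_out q + d) n) (over (k + legs_in q + d) n ++ [:: (k, q)]).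
Proof.
elim: n d => [|n IHn] d; first by split.
rewrite /over /= -!/(over _ _) -!addnS -IHn.
exact: (cat_equiv (equiv_Level k d q (Cross true)) (reflexivity (over _ n))).
Qed.

Lemma equiv_ctx u v l r : equiv l r -> equiv (u ++ l ++ v) (u ++ r ++ v).
Proof. by move=> lr; rewrite lr; reflexivity. Qed.

Lemma reduces_ctx u v l r : reduces l r -> reduces (u ++ l ++ v) (u ++ r ++ v).
Proof. by move=> lr; apply: cat_reduces => //; apply: cat_reduces. Qed.

Lemma reduces_via u v l r x y :
  reduces l r -> x = u ++ l ++ v -> reduces (u ++ r ++ v) y -> reduces x y.
Proof. by move=> lr -> ry; transitivity (u ++ r ++ v) => //; apply: reduces_ctx. Qed.

Lemma equiv_via u v l r x y :
  equiv l r -> x = u ++ l ++ v -> equiv (u ++ r ++ v) y -> equiv x y.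
Proof. by move=> lr -> ry; transitivity (u ++ r ++ v) => //; apply: equiv_ctx. Qed.

Lemma over_split i a b : over i (a + b.+2) =
  over i a ++ [:: ((i + a)%N, Cross true); ((i + a).+1, Cross true)] ++ over (i + a).+2 b.
Proof. by rewrite over_cat. Qed.

(** The over-strand lies above both strands of the crossing, so Reidemeister III applies whatever
    the value of [e]; the rest of the over-strand is distant from the crossing. *)
Lemma over_cross i a b e : equiv
  (over i (a + b.+2) ++ [:: ((i + a)%N, Cross e)]) (((i + a).+1, Cross e) :: over i (a + b.+2)).
Proof.
have /= H := piece_over (i + a) (Cross e) 0 b; rewrite addn0 addn2 in H.
rewrite over_split -!catA -H.
set X := [:: _; _].
etransitivity.
  exact: (equiv_ctx (over i a) (over (i + a).+2 b) (@equiv_R3 (i + a) true true e isT)).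
have F : equiv (over i a ++ [:: ((i + a).+1, Cross e)]) (((i + a).+1, Cross e) :: over i a).
  by apply: over_far.
etransitivity; last exact: (equiv_ctx [::] (X ++ over (i + a).+2 b) F).
by rewrite -catA; reflexivity.
Qed.

(** A slide across the maximum makes the two crossings with the capped strands opposite, and they
    cancel. This cancellation is why only [reduces] is claimed. *)
Lemma over_cap i a b : reduces
  (over i (a + b.+2) ++ [:: ((i + a)%N, Cap)]) (((i + a).+1, Cap) :: over i (a + b)).
Proof.
have /= H := piece_over (i + a) (@Cap bool) 0 b; rewrite !addn0 addn2 in H.
have F : equiv (over i a ++ [:: ((i + a).+1, Cap)]) (((i + a).+1, Cap) :: over i a).
  by apply: over_far.
rewrite over_split over_cat; set X := (_, Cross _); set Y := (_, Cross _).
apply: (reduces_via (u := over i a ++ [:: X; Y]) (v := [::]) (equiv_reduces (symmetry H))).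
  by rewrite cats0 -!catA.
rewrite cats0.
apply: (reduces_via (u := over i a ++ [:: X]) (v := over (i + a) b)
  (equiv_reduces (equiv_CapSlide (i + a) true))); first by rewrite -!catA.
apply: (reduces_via (u := over i a) (v := ((i + a).+1, Cap) :: over (i + a) b)
  (reduces_R2 (i + a) true)); first by rewrite -!catA.
apply: (reduces_via (u := [::]) (v := over (i + a) b) (equiv_reduces F)).
  by rewrite /= -!catA.
exact: reduces_refl.
Qed.

Lemma cup0_far c k q : equiv [:: (0%N, Cup c); (k.+2, q)] [:: (k, q); (0%N, Cup c)].
Proof. exact: (equiv_Level 0 k (Cup c) q). Qed.

Lemma arc_far c n k q : equiv
  (arc c n ++ [:: ((n + k).+2, q)]) (((n + k)%N, q) :: arc c n).
Proof.
have F : equiv (over 1 n ++ [:: ((n + k).+2, q)]) (((n + k).+2, q) :: over 1 n).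
  by apply: over_far; lia.
apply: (equiv_via (u := [:: (0%N, Cup c)]) (v := [::]) F); first by rewrite cats0.
by rewrite cats0; apply: (equiv_via (u := [::]) (v := over 1 n) (cup0_far c (n + k) q)).
Qed.

Lemma arc_cross c a b e : equiv
  (arc c (a + b.+2) ++ [:: (a.+1, Cross e)]) ((a, Cross e) :: arc c (a + b.+2)).
Proof.
apply: (equiv_via (u := [:: (0%N, Cup c)]) (v := [::]) (over_cross 1 a b e)).
  by rewrite cats0.
by rewrite cats0; apply: (equiv_via (u := [::]) (v := over 1 _) (cup0_far c a (Cross e))).
Qed.

Lemma arc_cap c a b : reduces
  (arc c (a + b.+2) ++ [:: (a.+1, Cap)]) ((a, Cap) :: arc c (a + b)).
Proof.
apply: (reduces_via (u := [:: (0%N, Cup c)]) (v := [::]) (over_cap 1 a b)).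
  by rewrite cats0.
rewrite cats0.
exact: (reduces_via (u := [::]) (v := over 1 _) (equiv_reduces (cup0_far c a Cap))).
Qed.

(** A converse of [reduces_R2] inside a context: the word [w] itself guarantees that the two strands
    exist. *)
Lemma insert_R2 w i e :
  (forall u t, run negb [::] (u ++ w) = Some t -> (i.+1 < size t)%N) ->
  reduces w (w ++ [:: (i, Cross e); (i, Cross (~~ e))]).
Proof.
move=> big; split=> u v agr; rewrite catA => dw.
case/andP: (dw) => _ /eqP; rewrite run_cat; case Eu: (run negb [::] _) => [t|] //= _.
by apply: (agree_R2 (e := e) Eu (big _ _ Eu) _ dw); rewrite -!catA in agr *.
Qed.

Lemma cup_under i c : equiv
  [:: (i.+1, Cup c); (i, Cross true); (i.+1, Cross true)]
  [:: (i, Cup c); (i.+1, Cross false); (i.+1, Cross true)].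
Proof.
exact: (equiv_via (u := [::]) (v := [:: (i.+1, Cross true)])
  (symmetry (equiv_CupSlide i c false))).
Qed.

(** The over-strand crosses both legs of the earlier cup; sliding it across the minimum makes these
    two crossings an opposite pair on one leg. Removing that pair gives the left side of
    [arc_cup_collapse]. *)
Lemma arc_cup_expand c a b c' : equiv ((a, Cup c') :: arc c (a + b.+2))
  (arc c a ++ [:: (a.+1, Cup c'); (a.+2, Cross false); (a.+2, Cross true)] ++ over a.+3 b).
Proof.
have F : equiv (over 1 a ++ [:: (a.+2, Cup c')]) ((a.+2, Cup c') :: over 1 a).
  by apply: over_far.
rewrite {1}/arc over_split add1n.
apply: (equiv_via (u := [::]) (symmetry (cup0_far c a (Cup c')))) => //.
apply: (equiv_via (u := [:: (0%N, Cup c)]) (symmetry F)) => //.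
apply: (equiv_via (u := arc c a) (v := over a.+3 b) (cup_under a.+1 c')).
  by rewrite /arc /= -?catA.
by reflexivity.
Qed.

Lemma arc_cup_collapse c a b c' : equiv
  (arc c a ++ [:: (a.+1, Cup c')] ++ over a.+3 b) (arc c (a + b) ++ [:: (a.+1, Cup c')]).
Proof.
have := piece_over a.+1 (Cup c') 0 b; rewrite /= !addn0 addn2 => H.
apply: (equiv_via (u := arc c a) (v := [::]) H); first by rewrite cats0.
by rewrite cats0 /arc over_cat /= -catA; reflexivity.
Qed.

(* A cup lying left of the right end of the top arc slides below that arc. *)
Lemma arc_cup c a b c' : equiv
  (arc c (a + b) ++ [:: (a.+1, Cup c')]) ((a, Cup c') :: arc c (a + b.+2)).
Proof.
rewrite -arc_cup_collapse arc_cup_expand.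
have sz u t : run negb [::] (u ++ arc c a ++ [:: (a.+1, Cup c')]) = Some t ->
    (a.+3 < size t)%N.
  rewrite catA run_cat; case Eu: (run _ _ (u ++ _)) => [t'|] //= .
  case Et: step => [t''|] //= [<-].
  by have := run_arc Eu; have /andP[_ /eqP] := step_size Et; rewrite /=; lia.
split.
- apply: (reduces_via (u := [::]) (v := over a.+3 b) (insert_R2 false sz)).
    by rewrite /= -!catA.
  by rewrite /= -!catA.
- apply: (reduces_via (u := arc c a ++ [:: (a.+1, Cup c')]) (v := over a.+3 b)
    (reduces_R2 a.+2 false)); first by rewrite -!catA.
  by rewrite -!catA.
Qed.

(** Iterates [over_cross] along the second over-strand. The bound on [a + q] keeps each of its
    crossings among strands that the first over-strand has passed. *)
Lemma over_over i a q p : (a + q <= p)%N ->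
  equiv (over i p.+2 ++ over (i + a.+1) q) (over (i + a.+2) q ++ over i p.+2).
Proof.
elim: q a => [|q IHq] a le_p; first by rewrite cats0; reflexivity.
have H := over_cross i a.+1 (p - a.+1) true.
have Ep : (a.+1 + (p - a.+1).+2 = p.+2)%N by lia.
rewrite Ep -!addnS in H.
apply: (equiv_via (u := [::]) (v := over (i + a.+2) q) H).
  by rewrite /= -catA (addnS i a.+1).
have {}IHq := IHq a.+1 ltac:(lia).
apply: (equiv_via (u := [:: ((i + a.+2)%N, Cross true)]) (v := [::]) IHq).
  by rewrite cats0 /= (addnS i a.+1).
by rewrite cats0 (addnS i a.+2); reflexivity.
Qed.

(** After the crossing both legs of the arc lie over the leftmost strand, so the cup can be pulled
    off it by a slide and Reidemeister II. *)
Lemma arc_cross0 c q :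
  equiv (arc c q.+1 ++ [:: (0%N, Cross true)]) ((1%N, Cup c) :: over 2 q).
Proof.
apply: (equiv_via (u := [:: (0%N, Cup c); (1%N, Cross true)]) (v := [::])
  (symmetry (piece_over 0 (Cross true) 0 q))); first by rewrite cats0.
rewrite cats0 addn0.
apply: (equiv_via (u := [::]) (v := (0%N, Cross true) :: over 2 q) (equiv_CupSlide 0 c true)) => //.
split.
  exact: (reduces_via (u := [:: (1%N, Cup c)]) (v := over 2 q) (reduces_R2 0 false)).
have sz u t : run negb [::] (u ++ [:: (1%N, Cup c)]) = Some t -> (1 < size t)%N.
  by move/run_size => /= ?; lia.
exact: (reduces_via (u := [::]) (v := over 2 q) (insert_R2 false sz)).
Qed.

(* Pulling the left end of the top arc across that of the next one lets the
   two arcs exchange their levels. *)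
Lemma arc_swap c c' p q : (q <= p)%N -> equiv
  (arc c p ++ arc c' q.+1 ++ [:: (0%N, Cross true)]) (arc c' q ++ arc c p.+2).
Proof.
move=> le_q_p.
apply: (equiv_via (u := arc c p) (v := [::]) (arc_cross0 c' q)); first by rewrite cats0.
apply: (equiv_via (u := [::]) (v := over 2 q) (arc_cup c 0 p c')).
  by rewrite cats0 /= -catA.
(* The second arc, pulled off the first strand, now starts as a cup below the other arc; its
   over-strand can pass to the lower level because [q <= p]. *)
apply: (equiv_via (u := [:: (0%N, Cup c'); (0%N, Cup c)]) (v := [::])
  (over_over 1 (a := 0) le_q_p)).
  by rewrite cats0.
apply: (equiv_via (u := [:: (0%N, Cup c')]) (v := over 1 p.+2) (piece_over 0 (Cup c) 1 q)).
  by rewrite cats0.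
by rewrite /= -catA; reflexivity.
Qed.

(* As far as the vanishing of [f - g] is concerned, [u] behaves like a linear
   combination of layered words with [m] arcs. *)
Definition good m u :=
  forall v, (forall w, layered m w -> agree (w ++ v)) -> agree (u ++ v).

Lemma good_layered m w : layered m w -> good m w.
Proof. by move=> mw v; apply. Qed.

Lemma good_reduces m u u' : reduces u u' -> good m u' -> good m u.
Proof. by case=> uu' gu' v /gu'; apply: (uu' [::]). Qed.

(** Extension by linearity: it suffices to treat the piece [x] after layered words. *)
Lemma good_bind m m' u x :
  good m u -> (forall w, layered m w -> good m' (w ++ x)) -> good m' (u ++ x).
Proof.
move=> gu gx v Zv; rewrite -catA; apply: gu => w /gx gwx.
by rewrite catA; apply: gwx.
Qed.

Lemma good_arc m u c n : good m u -> good m.+1 (u ++ arc c n).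
Proof. by move/good_bind; apply=> w mw; apply/good_layered/layeredS. Qed.

Lemma good_invalid m u : run negb [::] u = None -> good m u.
Proof. by move=> Eu v _ /andP[_]; rewrite run_cat Eu. Qed.

(** The skein relation determines one crossing from the other and the smoothing, as [s ^+ 2] is a
    unit. Which smoothing is the oriented one depends on the directions produced by [u], so
    agreement is assumed for both. *)
Lemma agree_skein u v i e :
  agree (u ++ (i, Cross (~~ e)) :: v) -> agree (u ++ v) ->
  (forall c, agree (u ++ [:: (i, Cap); (i, Cup c)] ++ v)) ->
  agree (u ++ (i, Cross e) :: v).
Proof.
move=> agrX agrV agrH dX.
have [t [t' [Eu Et Ev]]] := @diagram_run u [:: (i, Cross e)] v dX.
have lt_i_t : (i.+1 < size t)%N.
  by move: Et => /=; case Et: step => [t''|] //; have /andP[] := step_size Et; rewrite /=; lia.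
have [t1 [d [d' [t2 [def_t sz_t1]]]]] := size_split lt_i_t.
have dX' e' : oriented_diagram (u ++ (i, Cross e') :: v).
  apply: (@diagram_replace u [:: (i, Cross e)] [:: (i, Cross e')] v) dX.
  - exact: Eu.
  - by rewrite def_t -sz_t1; apply: run_Cross_at.
  - by rewrite def_t -sz_t1; apply: run_Cross_at.
  - by rewrite !size_cat /=; lia.
have nz_u : (0 < size u)%N by case: (u) Eu => // -[Et0]; rewrite -Et0 in lt_i_t.
have d0 : oriented_diagram (u ++ oriented_smoothing i d d' ++ v).
  apply: (@diagram_replace u [:: (i, Cross e)] _ v) dX.
  - exact: Eu.
  - by rewrite def_t -sz_t1; apply: run_Cross_at.
  - by rewrite def_t -sz_t1; apply: run_smoothing_at.
  - by rewrite size_cat ltn_addr.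
have fg0 : f (u ++ oriented_smoothing i d d' ++ v) = g (u ++ oriented_smoothing i d d' ++ v).
  move: d0; rewrite /oriented_smoothing; case: ifP => _; [exact: agrV | exact: agrH].
have s2u : s ^+ 2 \is a GRing.unit by rewrite unitrX.
rewrite def_t in Eu; rewrite -sz_t1 in dX dX' agrX fg0 *.
have := skein_rel f_skein (dX' _) Eu; rewrite /= fg0 -(skein_rel g_skein (dX' _) Eu) /=.
have := agrX (dX' _); case: (altP (e =P (d == d'))) => [<-|].
  by move=> -> /addIr; apply: mulrI; rewrite unitrV.
move=> ne; have -> : (d == d') = ~~ e by case: (e) (d == d') ne => [] [].
rewrite negbK => -> /addrI/oppr_inj; exact: mulrI.
Qed.

(** A kink of either kind on the strand [x] can be removed, and smoothing it splits off a circle.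
    The skein relation then expresses [s - s^-1] times the value with the circle through the value
    without it, and [s_reg] cancels the factor. *)
Lemma agree_circle u v x t c : run negb [::] u = Some (x :: t) ->
  agree (u ++ v) -> agree (u ++ circle c ++ v).
Proof.
move=> Eu agr.
have flip b : reduces (circle b) (circle (~~ b)).
  have R := equiv_R1Cap 0 true; have R' := equiv_R1Cup 0 b true.
  apply: (reduces_via (u := [:: (0%N, Cup b)]) (v := [::]) (equiv_reduces (symmetry R))) => //.
  exact: (reduces_via (u := [::]) (v := [:: (0%N, Cap)]) (equiv_reduces R')).
suff {c} : agree (u ++ circle (~~ x) ++ v).
  case: (c =P ~~ x) => [-> //|/eqP ne A].
  have -> : c = x by case: (c) (x) ne => [] [].
  by case: (flip x) => /(_ u v); apply.
have kink e : reduces [:: (0%N, Cup (~~ x)); (1%N, Cross e); (0%N, Cap)] [::].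
  apply: (reduces_via (u := [::]) (v := [:: (0%N, Cap)])
    (equiv_reduces (equiv_CupSlide 0 (~~ x) e))) => //.
  apply: (reduces_via (u := [:: (1%N, Cup (~~ x))]) (v := [::])
    (equiv_reduces (equiv_R1Cap 0 (~~ e)))) => //.
  exact: reduces_SnakeR.
move=> dD.
(* With this orientation the right leg of the cup is parallel to [x], so the oriented smoothing of
   their crossing is vertical and leaves exactly the circle. *)
have Eu' : run negb [::] (u ++ [:: (0%N, Cup (~~ x))]) = Some ([:: ~~ x] ++ [:: x, x & t]).
  by rewrite run_cat Eu /= negbK.
have dX e : oriented_diagram ((u ++ [:: (0%N, Cup (~~ x))]) ++ (1%N, Cross e) :: [:: (0%N, Cap) & v]).
  rewrite -catA.
  apply: (@diagram_replace u (circle (~~ x)) [:: (0%N, Cup (~~ x)); (1%N, Cross e); (0%N, Cap)] v) dD.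
  - exact: Eu.
  - by rewrite /= /step /= eqxx.
  - by rewrite /= /step /= !negbK eqxx.
  - by rewrite !size_cat /=; lia.
have fgX e : f ((u ++ [:: (0%N, Cup (~~ x))]) ++ (1%N, Cross e) :: [:: (0%N, Cap) & v]) =
  g ((u ++ [:: (0%N, Cup (~~ x))]) ++ (1%N, Cross e) :: [:: (0%N, Cap) & v]).
  by apply: (_ : agree _) (dX e); rewrite -catA; case: (kink e) => /(_ u v); apply.
have := @skein_rel _ _ _ f_skein _ _ [:: ~~ x] t x x (dX _) Eu'.
rewrite /= !fgX (@skein_rel _ _ _ g_skein _ _ [:: ~~ x] t x x (dX _) Eu').
rewrite /oriented_smoothing eqxx /= -!catA /= => /eqP; rewrite eq_sym -subr_eq0 -mulrBr.
by move=> /eqP/s_reg/eqP; rewrite subr_eq0 => /eqP.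
Qed.

(** * Layered words absorb cups, caps and crossings *)

Lemma good_push m w x y c n n' : reduces (arc c n ++ y) (x ++ arc c n') ->
  good m (w ++ x) -> good m.+1 ((w ++ arc c n) ++ y).
Proof.
move=> red gx; apply: (@good_reduces _ _ ((w ++ x) ++ arc c n')); last exact: good_arc.
by apply: (reduces_via (u := w) (v := [::]) red); rewrite cats0 -?catA.
Qed.

(** A cup at the far left is a new arc that crosses nothing. Any other cup slides below or beside
    the top arc and is absorbed by the earlier ones. *)
Lemma good_cup m w i c : layered m w -> good m.+1 (w ++ [:: (i, Cup c)]).
Proof.
move=> mw; elim: m w / mw i => [|m w c' n mw IHw] [|i].
- exact: good_layered (layeredS c 0 layered0).
- exact: good_invalid.
- exact/good_layered/(layeredS c 0)/layeredS.
have [le_i_n|lt_n_i] := leqP i n.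
  apply: (@good_push m.+1 _ [:: (i, Cup c)] _ _ _ n.+2) => //.
  by have [+ _] := arc_cup c' i (n - i) c; rewrite addnS addnS subnKC.
apply: (@good_push m.+1 _ [:: ((i.+1 - 2)%N, Cup c)] _ _ _ n) => //.
have [+ _] := arc_far c' n (i.+1 - n.+2) (Cup c); rewrite -!addSn subnKC // subSS.
by congr (reduces _ ([:: (_, _)] ++ _)); lia.
Qed.

Definition good_cross m := forall w i e, layered m w -> good m (w ++ [:: (i, Cross e)]).
Definition good_cap m := forall w i, layered m.+1 w -> good m (w ++ [:: (i, Cap)]).

Lemma good_over m w i n : good_cross m -> good m w -> good m (w ++ over i n).
Proof.
move=> X; elim: n w i => [|n IHn] w i gw; first by rewrite cats0.
rewrite -[over i n.+1]/([:: (i, Cross true)] ++ over i.+1 n) catA.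
by apply/IHn/(good_bind gw) => w' mw'; apply: X.
Qed.

(** The cap joins the right end of the top arc to the strand beyond it. Sliding the last crossing
    over the cap shortens the arc by one and leaves a crossing of earlier strands, absorbed by the
    hypothesis; with no crossing left the arc is a snake. *)
Lemma good_cap_right m w c n : good_cross m -> layered m w ->
  good m (w ++ arc c n ++ [:: (n.+1, Cap)]).
Proof.
move=> X; elim: n w => [|n IHn] w mw.
  apply: (@good_reduces _ _ w); last exact: good_layered.
  by apply: (reduces_via (u := w) (v := [::]) (reduces_SnakeL 0 c)); rewrite !cats0.
apply: (@good_reduces _ _ ((w ++ [:: (n, Cross false)]) ++ arc c n ++ [:: (n.+1, Cap)])).
  apply: (reduces_via (u := w ++ arc c n) (v := [::])
    (equiv_reduces (symmetry (equiv_CapSlide n.+1 false)))).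
    by rewrite cats0 arcS -!catA.
  have := arc_far c n 0 (Cross false); rewrite !addn0 => F.
  apply: (reduces_via (u := w) (v := [:: (n.+1, Cap)]) (equiv_reduces F)).
    by rewrite cats0 -!catA.
  by rewrite -!catA.
by apply: (good_bind (X _ _ _ mw)) => w' /IHn.
Qed.

(** A strand next to the circle is needed for [agree_circle]. If [w] has none, either the diagram is
    the circle alone, where [fg_circle] applies, or the next piece is a cup, and the circle is moved
    past it. *)
Lemma good_circle m w c : layered m w -> good m (w ++ circle c).
Proof.
case=> [|{}m {}w c' n mw] v Zv; last first.
  rewrite -catA => d; have := Zv _ (layeredS c' n mw); move: d.
  set u := w ++ arc c' n => d agr; have [t [_ [Et _ _]]] := diagram_run d.
  case: t Et => [|x t] Et; first by have := run_arc Et.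
  exact: agree_circle Et agr d.
have := Zv _ layered0; case: v {Zv} => [|h v] agr d; first exact: fg_circle.
have [c' def_h] : exists c', h = (0%N, Cup c').
  have Ec : run negb [::] (circle c) = Some [::] by case: c {d}.
  case/andP: (d) => _; rewrite run_cat Ec [obind _ _]/=.
  case E: (step negb [::] h) => [t|] //= _.
  by have [c' -> _] := step_nil E; exists c'.
move: agr d; rewrite def_h => agr.
suff red : reduces ([::] ++ circle c ++ [:: (0%N, Cup c')]) ([:: (0%N, Cup c')] ++ circle c).
  case: red => /(_ [::] v); apply; rewrite /= => d.
  exact: (@agree_circle [:: (0%N, Cup c')] v _ _ c _ agr d).
apply: (reduces_via (u := [:: (0%N, Cup c)]) (v := [::])
  (equiv_reduces (equiv_Level 0 0 Cap (Cup c')))) => //.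
exact: (reduces_via (u := [::]) (v := [:: (0%N, Cap)])
  (equiv_reduces (equiv_Level 0 0 (Cup c) (Cup c')))).
Qed.

(** Case analysis on the place of the cap relative to the ends 0 and [n.+1] of the top arc. *)
Lemma good_cap_step m : good_cross m ->
  (forall m', m = m'.+1 -> good_cap m') -> good_cap m.
Proof.
move=> X N w i mw; inversion mw as [|m1 w' c n mw' E1 E2]; subst m1 w.
(* A cap that slides before the top arc is absorbed by the earlier arcs; with no earlier arc there
   are no strands for it to join. *)
have push k n' y : reduces (arc c n ++ y) ([:: (k, Cap)] ++ arc c n') ->
    good m ((w' ++ arc c n) ++ y).
  case: m N mw' {X mw} => [|m] N mw' red; last first.
    by apply: good_push red _; apply: (N m).
  inversion mw'; apply: (good_reduces (u' := [:: (k, Cap)] ++ arc c n') red).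
  exact: good_invalid.
have [le_i_n|lt_n_i] := leqP i n.+1; last first.
  apply: (push (i - 2)%N n); have [+ _] := arc_far c n (i - n.+2) (@Cap bool).
  by rewrite -!addSn subnKC //; congr (reduces _ ([:: (_, _)] ++ _)); lia.
rewrite -catA; case: i le_i_n => [_|i le_i_n].
  case: n {mw push} => [|n]; first exact: good_circle.
  (* The cap joins the left end to the first strand under the arc. The resulting kink and snake
     straighten, and that strand continues over the other [n]. *)
  apply: (@good_reduces _ _ (w' ++ over 0 n)); last exact/good_over/good_layered.
  apply: (reduces_via (u := w' ++ [:: (0%N, Cup c); (1%N, Cross true)]) (v := [::])
    (equiv_reduces (symmetry (piece_over 0 Cap 0 n)))).
    by rewrite cats0 -!catA.
  apply: (reduces_via (u := w') (v := [:: (0%N, Cap)] ++ over 0 n)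
    (equiv_reduces (equiv_CupSlide 0 c true))); first by rewrite cats0 -!catA.
  apply: (reduces_via (u := w' ++ [:: (1%N, Cup c)]) (v := over 0 n)
    (equiv_reduces (equiv_R1Cap 0 false))); first by rewrite -!catA.
  apply: (reduces_via (u := w') (v := over 0 n) (reduces_SnakeR 0 c)) => //.
  by rewrite -!catA.
have [lt_i_n|] := ltnP i.+1 n.
  rewrite catA; apply: (push i (i + (n - i.+2))%N).
  by have := arc_cap c i (n - i.+2); rewrite -addSnnS -addSnnS subnKC.
rewrite leq_eqVlt => /predU1P[Ei|lt_n_i]; last first.
  have -> : i = n by lia.
  exact: good_cap_right.
(* The cap joins the right end to the strand it crossed last, so Reidemeister I removes that
   crossing. *)
rewrite Ei arcS; apply: (@good_reduces _ _ (w' ++ arc c i ++ [:: (i.+1, Cap)])).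
  apply: (reduces_via (u := w' ++ arc c i) (v := [::]) (equiv_reduces (equiv_R1Cap i.+1 true)));
    by rewrite cats0 -!catA.
exact: good_cap_right.
Qed.


(** In the skein relation the vertical smoothing is [w] itself, and the horizontal one is a cap
    followed by a cup, which lowers the number of arcs and restores it. *)
Lemma good_sign m w i e : good_cap m -> layered m.+1 w ->
  good m.+1 (w ++ [:: (i, Cross (~~ e))]) -> good m.+1 (w ++ [:: (i, Cross e)]).
Proof.
move=> N mw gX v Zv; rewrite -catA; apply: agree_skein.
- by have := gX v Zv; rewrite -catA.
- exact: Zv.
- move=> c; rewrite (catA w); apply: (_ : good m.+1 _) v Zv.
  rewrite -[[:: _; _]]/([:: (i, Cap)] ++ [:: (i, Cup c)]) catA.
  by apply/(good_bind (N _ _ mw)) => w' mw'; apply: good_cup.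
Qed.

(** By [good_sign] it is enough to treat one of the two crossings, and each position of the crossing
    admits a convenient choice. *)
Lemma good_cross_step m : good_cross m -> good_cap m -> good_cross m.+1.
Proof.
move=> X N w i e mw.
suff [e' ge'] : exists e', good m.+1 (w ++ [:: (i, Cross e')]).
  case: (e =P e') => [-> //|/eqP ne]; apply: good_sign => //.
  by have -> : ~~ e = e' by case: (e) (e') ne => [] [].
inversion mw as [|m1 w' c n mw' E1 E2]; subst m1 w.
have [le_i_n|lt_n_i] := leqP i n.+1; last first.
  exists true; apply: (good_push (x := [:: ((i - 2)%N, Cross true)]) (n' := n)); last exact: X.
  have [+ _] := arc_far c n (i - n.+2) (Cross true).
  by rewrite -!addSn subnKC //; congr (reduces _ ([:: (_, _)] ++ _)); lia.
case: i le_i_n => [_|i le_i_n].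
  case: n {mw} => [|n].
    exists true; apply: (@good_reduces _ _ (w' ++ arc (~~ c) 0)).
      apply: (reduces_via (u := w') (v := [::]) (equiv_reduces (equiv_R1Cup 0 c true))) => //.
      by rewrite cats0 -!catA.
    exact/good_layered/layeredS.
  inversion mw' as [|m1 w c' p mw E1 E2]; subst.
    by exists true; apply: good_invalid.
  have [le_n_p|lt_p_n] := leqP n p.
    (* The left ends of the two top arcs cross, and [arc_swap] exchanges the levels of the arcs. *)
    exists true; apply: (@good_reduces _ _ ((w ++ arc c n) ++ arc c' p.+2)).
      apply: (reduces_via (u := w) (v := [::]) (equiv_reduces (arc_swap c' c le_n_p)));
        by rewrite cats0 -!catA.
    exact/good_layered/layeredS/layeredS.
  case: n lt_p_n => // n le_p_n.
  (* The inequality now favours the other arc: [arc_swap] is read backwards, and the crossing it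
     creates cancels with the given one. *)
  exists false; apply: (@good_reduces _ _ ((w ++ arc c n) ++ arc c' p.+1)).
    apply: (reduces_via (u := w) (v := [:: (0%N, Cross false)])
      (equiv_reduces (symmetry (@arc_swap c c' n p le_p_n)))); first by rewrite -!catA.
    apply: (reduces_via (u := w ++ arc c n ++ arc c' p.+1) (v := [::]) (reduces_R2 0 true));
      by rewrite ?cats0 -!catA.
  exact/good_layered/layeredS/layeredS.
have [lt_i_n|] := ltnP i.+1 n.
  exists true; apply: (good_push (x := [:: (i, Cross true)]) (n' := n)); last exact: X.
  by have [+ _] := arc_cross c i (n - i.+2) true; rewrite -addSnnS -addSnnS subnKC.
rewrite leq_eqVlt => /predU1P[Ei|lt_n_i]; last first.
  have Ei : i = n by lia.
  exists true; rewrite Ei -catA -arcS; exact/good_layered/layeredS.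
(* This choice cancels the last crossing of the top arc; one position further right, the other
   choice extended the arc. *)
exists false; rewrite Ei arcS; apply: (@good_reduces _ _ (w' ++ arc c i)).
  apply: (reduces_via (u := w' ++ arc c i) (v := [::]) (reduces_R2 i.+1 true));
    by rewrite ?cats0 -?catA.
exact/good_layered/layeredS.
Qed.

(** Joint induction: a cap on [m.+1] arcs may leave crossings on [m] arcs, and a crossing on [m.+1]
    arcs may be smoothed to a cap on them. *)
Lemma good_cross_cap m : good_cross m /\ good_cap m.
Proof.
elim: m => [|m [X N]].
  have X0 : good_cross 0 by move=> w i e mw; inversion mw; apply: good_invalid; case: i.
  by split => //; apply: good_cap_step.
have X1 := good_cross_step X N; split => //.
by apply: good_cap_step => // m' [<-].
Qed.

(** Absorbs the pieces of [v] one by one. At the end, a layered word with an arc has open ends, and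
    the empty word is not a diagram, so agreement is vacuous. *)
Lemma agree_layered v m w : layered m w -> agree (w ++ v).
Proof.
elim: v m w => [|[i p] v IHv] m w mw.
  case: mw => [//|{}m {}w c n _] /andP[_ /eqP]; rewrite cats0 => Ew.
  by have := run_arc Ew.
rewrite -[(i, p) :: v]/([:: (i, p)] ++ v) catA.
case: p => [c||e].
- by apply: (@good_cup m); last exact: IHv.
- case: mw => [|{}m {}w c n mw].
    by apply: (@good_invalid 0); [case: i | exact: IHv].
  by apply: (good_cross_cap m).2; [exact: layeredS | exact: IHv].
- by apply: (good_cross_cap m).1; [exact: mw | exact: IHv].
Qed.

Theorem skein_unique D : oriented_diagram D -> f D = g D.
Proof. by move=> dD; have := agree_layered (v := D) layered0; apply. Qed.

End Uniqueness.

(** * Substitution in Laurent polynomials *)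

Section LaurentSubst.
Variables (R : idomainType) (S : comUnitRingType) (f : {rmorphism R -> S}) (u : S).
Hypothesis u_unit : u \is a GRing.unit.
Implicit Types x y : laurent R.

(** Frees the substitution from the chosen representation: two fractions for [x] are
    cross-multiplied, and the equality survives evaluation at the unit [u]. *)
Lemma laurent_substE x (p : {poly R}) n :
  laurent_val x = p%:F / ('X ^+ n)%:F -> laurent_subst f u x = (map_poly f p).[u] / u ^+ n.
Proof.
rewrite /laurent_subst; have := xchooseP (laurent_ex_repr x).
case: (xchoose _) => q m /eqP /= ->.
move/eqP; rewrite GRing.eqr_div ?tofracXn_neq0 // -!tofracM tofrac_eq.
move/eqP/(congr1 (fun p => (map_poly f p).[u])).
rewrite !rmorphM !rmorphXn /= map_polyX !hornerE => E.
apply: (mulIr (unitrX m u_unit)); rewrite divrK ?unitrX //.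
by rewrite mulrAC -E mulrK ?unitrX.
Qed.

Lemma laurent_subst_poly (p : {poly R}) : laurent_subst f u (laurent_poly p) = (map_poly f p).[u].
Proof. by rewrite (@laurent_substE _ p 0) ?divr1 //= expr0 tofrac1 divr1. Qed.

Lemma laurent_subst_is_zmod_morphism : zmod_morphism (laurent_subst f u).
Proof.
move=> x y; have [[p m] /eqP /= Ex] := laurent_ex_repr x.
have [[q n] /eqP /= Ey] := laurent_ex_repr y.
rewrite (laurent_substE Ex) (laurent_substE Ey).
rewrite (@laurent_substE _ (p * 'X^n - q * 'X^m) (m + n)).
  rewrite rmorphB !rmorphM !rmorphXn /= map_polyX !hornerE.
  apply: (mulIr (unitrX (m + n) u_unit)); rewrite divrK ?unitrX // mulrBl exprD.
  congr (_ - _); first by rewrite mulrA divrK ?unitrX.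
  by rewrite [u ^+ m * _]mulrC mulrA divrK ?unitrX.
apply: etrans (rmorphB \val x y) _; rewrite /= Ex Ey exprD tofracB !tofracM -mulNr.
by rewrite addf_div ?tofracXn_neq0 // mulNr.
Qed.

Lemma laurent_subst_is_monoid_morphism : monoid_morphism (laurent_subst f u).
Proof.
split.
  rewrite (@laurent_substE _ 1 0); first by rewrite rmorph1 hornerC divr1.
  by rewrite expr0 tofrac1 divr1; apply: (rmorph1 \val).
move=> x y; have [[p m] /eqP /= Ex] := laurent_ex_repr x.
have [[q n] /eqP /= Ey] := laurent_ex_repr y.
rewrite (laurent_substE Ex) (laurent_substE Ey).
rewrite (@laurent_substE _ (p * q) (m + n)).
  by rewrite rmorphM hornerM exprD invrM ?unitrX // [(u ^+ n)^-1 * _]mulrC mulrACA.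
apply: etrans (rmorphM \val x y) _; rewrite /= Ex Ey exprD !tofracM.
by rewrite mulf_div.
Qed.
End LaurentSubst.

(** Inherited from the field of fractions. *)
Lemma laurent_regular (R : idomainType) (x y : laurent R) : x * y = 0 -> x != 0 -> y = 0.
Proof.
move=> /(congr1 \val) xy0 x0; apply: val_inj.
have /eqP : val x * val y = 0.
  exact: etrans (esym (rmorphM \val x y)) (etrans xy0 (rmorph0 \val)).
rewrite mulf_eq0 (negPf (laurent_val_neq0 x0)) /= => /eqP y0.
exact: y0.
Qed.

Lemma laurent_polyM (R : idomainType) : monoid_morphism (@laurent_poly R).
Proof.
split; first by apply: val_inj; rewrite /= tofrac1.
by move=> p q; apply: val_inj; rewrite /= tofracM.
Qed.

Lemma laurent_polyB (R : idomainType) : zmod_morphism (@laurent_poly R).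
Proof.
by move=> p q; apply: val_inj; rewrite /= tofracB.
Qed.

HB.instance Definition _ (R : idomainType) :=
  GRing.isZmodMorphism.Build {poly R} (laurent R) (@laurent_poly R) (@laurent_polyB R).
HB.instance Definition _ (R : idomainType) :=
  GRing.isMonoidMorphism.Build {poly R} (laurent R) (@laurent_poly R) (@laurent_polyM R).
HB.instance Definition _ (R : idomainType) :=
  GRing.RMorphism.copy (@laurentC R) (@laurent_poly R \o polyC).

Lemma laurentX_unit (R : idomainType) : laurentX R \is a GRing.unit.
Proof.
suff [y yX] : exists y : laurent R, y * laurentX R = 1 by apply: (laurent_unitP yX).
have y_laurent : ('X : {poly R})%:F^-1 \in @is_laurent R.
  by apply/is_laurentP; exists (1, 1%N); rewrite /laurent_repr /= expr1 tofrac1 div1r.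
exists (Laurent y_laurent); apply: val_inj.
apply: etrans (rmorphM \val _ _) _; apply: etrans _ (esym (rmorph1 \val)).
by rewrite /= mulVf // -(expr1 'X) tofracXn_neq0.
Qed.

Fact root4_unit : root4_t \is a GRing.unit. Proof. exact: laurentX_unit. Qed.

Fact root4V_unit : root4_t^-1 \is a GRing.unit. Proof. by rewrite unitrV root4_unit. Qed.

HB.instance Definition _ := GRing.isZmodMorphism.Build ZAc Zqc subst_A
  (@laurent_subst_is_zmod_morphism {poly int} Zqc (@laurentC {poly int}) _ root4V_unit).
HB.instance Definition _ := GRing.isMonoidMorphism.Build ZAc Zqc subst_A
  (@laurent_subst_is_monoid_morphism {poly int} Zqc (@laurentC {poly int}) _ root4V_unit).

Fact root4_sqr_unit : root4_t ^+ 2 \is a GRing.unit.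
Proof. by rewrite unitrX ?root4_unit. Qed.

HB.instance Definition _ := GRing.isZmodMorphism.Build Zs Zqc subst_s
  (@laurent_subst_is_zmod_morphism int Zqc intr _ root4_sqr_unit).
HB.instance Definition _ := GRing.isMonoidMorphism.Build Zs Zqc subst_s
  (@laurent_subst_is_monoid_morphism int Zqc intr _ root4_sqr_unit).

Lemma subst_A_var : subst_A varA = root4_t^-1.
Proof. by rewrite /subst_A /varA laurent_subst_poly ?root4V_unit // map_polyX hornerX. Qed.

Lemma subst_s_sqrt : subst_s sqrt_t = root4_t ^+ 2.
Proof. by rewrite /subst_s /sqrt_t laurent_subst_poly ?root4_sqr_unit // map_polyX hornerX. Qed.

(** If the factor were zero, the fourth power of [root4_t] would be 1, against the degrees of the
    polynomials. *)
Lemma root4_sqr_regular (x : Zqc) :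
  (root4_t ^+ 2 - (root4_t ^+ 2)^-1) * x = 0 -> x = 0.
Proof.
move/laurent_regular; apply; apply/eqP => /subr0_eq E.
have : laurent_poly ('X^4 : {poly {poly int}}) = laurent_poly 1.
  rewrite rmorphXn rmorph1 /=.
  by have := mulrV root4_sqr_unit; rewrite -E -exprD.
move/(congr1 val)/eqP; rewrite /= tofrac_eq => /eqP/(congr1 (fun p : {poly _} => size p)).
by rewrite size_polyXn size_poly1.
Qed.

(** * Recolouring and writhe *)

Section Recolor.
Variables (C C' : eqType) (dual : C -> C) (dual' : C' -> C') (h : C -> C').
Hypothesis h_dual : forall c, h (dual c) = dual' (h c).

Lemma recolor_cat (u v : word C) : recolor h (u ++ v) = recolor h u ++ recolor h v.
Proof. exact: map_cat. Qed.

Lemma run_recolor s s' (D : word C) :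
  run dual s D = Some s' -> run dual' (map h s) (recolor h D) = Some (map h s').
Proof.
elim: D s => [|[i p] D IHD] s /=; first by case=> ->.
case E: step => [t|] //= /IHD {IHD}Et.
suff -> : step dual' (map h s) (i, map_piece h p) = Some (map h t) by [].
move: E; rewrite /step /= size_map -map_take -map_drop; case: p => [c||e] /=.
- by case: ifP => // _ [<-]; rewrite map_cat /= h_dual.
- case: (drop i s) => [|a [|b r]] //=; case: eqP => // -> [<-].
  by rewrite h_dual eqxx map_cat.
- by case: (drop i s) => [|a [|b r]] //= [<-]; rewrite map_cat.
Qed.

Lemma diagram_recolor (D : word C) : diagram dual D -> diagram dual' (recolor h D).
Proof. by case/andP=> nz /eqP/run_recolor E; rewrite /diagram E size_map nz /=. Qed.

Lemma recolor_comp (C2 : eqType) (h' : C' -> C2) (D : word C) :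
  recolor h' (recolor h D) = recolor (h' \o h) D.
Proof. by rewrite /recolor -map_comp; apply: eq_map => -[i []]. Qed.

Lemma colors_recolor (D : word C) : colors (recolor h D) = map h (colors D).
Proof. by elim: D => [|[i [c||e]] D IHD] //=; rewrite IHD. Qed.

Lemma planar_move_recolor l r :
  planar_move l r -> planar_move (recolor h l) (recolor h r).
Proof.
case=> [i k p q|i c|i c|i c e|i e] /=; try by constructor.
have <- : legs_out (map_piece h p) = legs_out p by case: p.
have <- : legs_in (map_piece h p) = legs_in p by case: p.
exact: Level.
Qed.

Lemma R2_recolor l r : @reidemeister2 C l r -> reidemeister2 (recolor h l) (recolor h r).
Proof. by case=> i e; apply: R2. Qed.

Lemma R3_recolor l r : @reidemeister3 C l r -> reidemeister3 (recolor h l) (recolor h r).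
Proof. by case=> i a b c abc; apply: R3. Qed.

End Recolor.

Lemma colors_neq0 (C : eqType) (dual : C -> C) (D : word C) :
  diagram dual D -> (0 < size (colors D))%N.
Proof.
case: D => // g D /andP[_] /=; case E: step => [t|] // _.
by have [c -> _] := step_nil E.
Qed.

(** * Change of the writhe under the moves *)

Definition piece_writhe (s : seq bool) (g : nat * piece bool) : int :=
  if g.2 is Cross e then
    if crossing_sign e (nth true s g.1) (nth true s g.1.+1) then 1 else -1
  else 0.

Lemma writhe_from_cons s s' g D : step negb s g = Some s' ->
  writhe_from s (g :: D) = piece_writhe s g + writhe_from s' D.
Proof. by rewrite /= => ->. Qed.

Lemma writhe_from_cat s s' u v : run negb s u = Some s' ->
  writhe_from s (u ++ v) = writhe_from s u + writhe_from s' v.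
Proof.
elim: u s => [|g u IHu] s /=; first by case=> ->; rewrite add0r.
by case: step => //= t /IHu ->; rewrite addrA.
Qed.

Lemma writhe_from_shift s1 s2 s' D : run negb s2 D = Some s' ->
  writhe_from (s1 ++ s2) (shift (size s1) D) = writhe_from s2 D.
Proof.
elim: D s2 => [|[i p] D IHD] s2 //=; rewrite step_cat.
case: step => //= t /IHD ->; congr (_ + _).
by rewrite -addnS !nth_cat !ltnNge !leq_addr !addKn.
Qed.

(** Equal strands above [l] and [r] are part of the condition, so that the rest of the diagram
    contributes the same writhe. *)
Definition writhe_drop (k : int) (l r : word bool) := forall s s', run negb s l = Some s' ->
  run negb s r = Some s' /\ writhe_from s l = writhe_from s r + k.

Lemma writhe_drop_shift k i l r : (0 < size l)%N ->
  writhe_drop k l r -> writhe_drop k (shift i l) (shift i r).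
Proof.
move=> l0 lr s s' El; have [le_i_s|lt_s_i] := leqP i (size s); last first.
  by rewrite run_shift_short in El.
split; first by apply: run_le_shift El => // t t' /lr[].
move: El; rewrite run_shift_drop //; case El: run => [t|] // _.
have [Er wE] := lr _ _ El.
rewrite -(cat_take_drop i s) -[X in shift X l](size_takel le_i_s).
rewrite -[X in shift X r](size_takel le_i_s).
by rewrite (writhe_from_shift _ El) (writhe_from_shift _ Er).
Qed.

Lemma writhe_drop_local k u v l r : writhe_drop k l r ->
  oriented_diagram (u ++ l ++ v) -> writhe (u ++ l ++ v) = writhe (u ++ r ++ v) + k.
Proof.
move=> lr /diagram_run[t [t' [Eu El _]]]; have [Er wE] := lr _ _ El.
rewrite /writhe !(writhe_from_cat _ Eu) (writhe_from_cat _ El) (writhe_from_cat _ Er) wE.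
by rewrite -!addrA [k + _]addrC.
Qed.

Lemma writhe_drop_R2 l r : reidemeister2 l r -> writhe_drop 0 l r.
Proof.
case=> i e; have := @writhe_drop_shift 0 i [:: (0%N, Cross e); (0%N, Cross (~~ e))] [::] isT.
rewrite /= addn0; apply=> s s' E; split; first exact: run_le_R2 E.
move: E; case: s => [|a [|b s]] // _.
by case: e a b => [] [] [].
Qed.

Lemma writhe_drop_R3 l r : reidemeister3 l r -> writhe_drop 0 l r.
Proof.
case=> i a b c _.
have := @writhe_drop_shift 0 i [:: (0%N, Cross a); (1%N, Cross b); (0%N, Cross c)]
   [:: (1%N, Cross c); (0%N, Cross b); (1%N, Cross a)] isT.
rewrite /= addn0 addn1; apply => s s' E; split; first by rewrite -E -run_R3.
move: E; case: s => [|x [|y [|z s]]] // _.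
rewrite /= addr0; set X := if _ then _ else _; set Y := if _ then _ else _.
by set Z := if _ then _ else _; rewrite !addr0 addrC [Y + Z]addrC addrA.
Qed.

(** The two strands of a kink at an extremum have opposite directions, so [Cross true] is negative
    there. *)
Lemma writhe_drop_R1Cup i c e : writhe_drop (if e then -1 else 1)
  [:: (i, Cup c); (i, Cross e)] [:: (i, Cup (~~ c))].
Proof.
have := @writhe_drop_shift (if e then -1 else 1) i
  [:: (0%N, Cup c); (0%N, Cross e)] [:: (0%N, Cup (~~ c))] isT.
rewrite /= addn0; apply=> s s' E; split; first by rewrite -E run_R1Cup //; apply: negbK.
by case: s c e {E} => [|a [|b s]] [] [].
Qed.

Lemma writhe_drop_R1Cap i e : writhe_drop (if e then -1 else 1)
  [:: (i, Cross e); (i, Cap)] [:: (i, Cap)].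
Proof.
have := @writhe_drop_shift (if e then -1 else 1) i
  [:: (0%N, Cross e); (0%N, Cap)] [:: (0%N, Cap)] isT.
rewrite /= addn0; apply=> s s' E; split; first by rewrite -E run_R1Cap //; apply: negbK.
by case: s E => [|a [|b s]] //; case: e a b => [] [] [].
Qed.

(** A level exchange permutes two summands. A slide across an extremum flips both the crossing and
    the relative direction of its strands, which keeps the sign. *)
Lemma writhe_drop_planar l r : planar_move l r -> writhe_drop 0 l r.
Proof.
case=> [i k p q|i c|i c|i c e|i e] /=.
- have := @writhe_drop_shift 0 i [:: (0%N, p); ((legs_out p + k)%N, q)]
    [:: ((legs_in p + k)%N, q); (0%N, p)] isT.
  rewrite /= !addnA !addn0; apply=> s s' E; split.
    by rewrite -E; apply: esym (run_Level negb 0 k p q s).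
  have [t [Et Eq]] : exists t, step negb s (0%N, p) = Some t /\
      step negb t ((legs_out p + k)%N, q) = Some s'.
    by move: E; rewrite /=; case: step => //= t; case Eq: step => //= -[<-]; exists t.
  have [t' [Eq' Et']] : exists t', step negb s ((legs_in p + k)%N, q) = Some t' /\
      step negb t' (0%N, p) = Some s'.
    move: E; have := run_Level negb 0 k p q s; rewrite !add0n => ->; rewrite /=.
    by case: step => //= t'; case Et': step => //= -[<-]; exists t'.
  rewrite (writhe_from_cons _ Et) (writhe_from_cons _ Eq).
  rewrite (writhe_from_cons _ Eq') (writhe_from_cons _ Et') /= !addr0.
  case: p {E} Et Eq Eq' Et' => [c||e].
  - by rewrite step_Cup0 => -[<-] _ _ _; rewrite addrC; congr (_ + _).
  - case: s => [|a [|b s]] //; rewrite step_Cap0; case: ifP => // _ [<-] _ _ _.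
    by rewrite addrC; congr (_ + _).
  - case: s => [|a [|b s]] //; rewrite step_Cross0 => -[<-] _.
    have /= -> := step_cat negb [:: a; b] s k q; case: step => //= t2 [<-] _.
    by rewrite addrC; congr (_ + _).
- by move=> s s' E; rewrite (run_le_SnakeL negbK E) /= !addr0.
- by move=> s s' E; rewrite (run_le_SnakeR negbK E) /= !addr0.
- have := @writhe_drop_shift 0 i [:: (0%N, Cup c); (1%N, Cross e)]
    [:: (1%N, Cup c); (0%N, Cross (~~ e))] isT.
  rewrite /= addn0 addn1; apply=> s s' E; split; first by rewrite -E -run_CupSlide.
  by case: s E => [|a s] // _; rewrite /= /step /= !take0 !drop0 /=; case: e c a => [] [] [].
- have := @writhe_drop_shift 0 i [:: (1%N, Cross e); (0%N, Cap)]
    [:: (0%N, Cross (~~ e)); (1%N, Cap)] isT.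
  rewrite /= addn0 addn1; apply=> s s' E; split; first by rewrite -E -run_CapSlide.
  by case: s E => [|a [|b [|c s]]] //; rewrite /= /step /=; case: e a b c => [] [] [] [].
Qed.

(** * The double bracket with a single class *)

Lemma locally_recolor (C C' : eqType) (h : C -> C') (P : word C -> word C -> Prop)
    (Q : word C' -> word C' -> Prop) D D' :
  (forall l r, P l r -> Q (recolor h l) (recolor h r)) ->
  locally P D D' -> locally Q (recolor h D) (recolor h D').
Proof.
move=> PQ [u l r v lr]; rewrite /recolor !map_cat.
exact/Locally/PQ.
Qed.

Lemma run_circle t i c : (i <= size t)%N ->
  run negb t [:: (i, Cup c); (i, Cap)] = Some t.
Proof.
move=> le_i_t; have := run_shift_drop negb [:: (0%N, Cup c); (0%N, Cap)] le_i_t.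
rewrite /= addn0 => ->; rewrite /step /= take0 drop0 /= eqxx /=.
by rewrite drop0 cat_take_drop.
Qed.

Lemma varA_unit : varA \is a GRing.unit. Proof. exact: laurentX_unit. Qed.

Section OneClass.
Variables (bracket : word nat -> ZAc) (hbracket : is_double_bracket bracket).

Definition one_class (D : word bool) : word nat := recolor (fun=> 0%N) D.
(** The ordinary Kauffman bracket of the unoriented diagram, as [kauffman_smooth] and
    [kauffman_circle] show. *)
Definition kauffman D := bracket (one_class D).

Lemma one_class_cat u v : one_class (u ++ v) = one_class u ++ one_class v.
Proof. exact: recolor_cat. Qed.

Lemma one_class_diagram D : oriented_diagram D -> tied_diagram (one_class D).
Proof. exact: diagram_recolor. Qed.

Lemma kauffman_planar : invariant_under negb kauffman (locally (@planar_move bool)).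
Proof.
move=> D D' dD dD' m; apply: (bracket_isotopy hbracket); try exact: one_class_diagram.
by left; apply: locally_recolor m; apply: planar_move_recolor.
Qed.

Lemma kauffman_R2 : invariant_under negb kauffman (locally (@reidemeister2 bool)).
Proof.
move=> D D' dD dD' m; apply: (bracket_R2 hbracket); try exact: one_class_diagram.
by apply: locally_recolor m; apply: R2_recolor.
Qed.

Lemma kauffman_R3 : invariant_under negb kauffman (locally (@reidemeister3 bool)).
Proof.
move=> D D' dD dD' m; apply: (bracket_R3 hbracket); try exact: one_class_diagram.
by apply: locally_recolor m; apply: R3_recolor.
Qed.

(** All strands have class 0, so the tied smoothing rule applies at every crossing. The direction
    [d] is arbitrary because it is forgotten. *)
Lemma kauffman_smooth u v i e d : oriented_diagram (u ++ (i, Cross e) :: v) ->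
  kauffman (u ++ (i, Cross e) :: v) =
    let hor := kauffman (u ++ [:: (i, Cap); (i, Cup d)] ++ v) in
    if e then varA * kauffman (u ++ v) + varA^-1 * hor
    else varA * hor + varA^-1 * kauffman (u ++ v).
Proof.
move=> dD; have := one_class_diagram dD; rewrite /kauffman !one_class_cat /=.
case/(@diagram_run u [:: (i, Cross e)] v): dD => t [t' [Eu Et _]].
have {Et}lt_i_t : (i.+1 < size t)%N.
  by move: Et => /=; case Et: step => [t''|] //; have /andP[] := step_size Et; rewrite /=; lia.
have [t1 [d1 [d2 [t2 [Et sz_t1]]]]] := size_split lt_i_t.
have {}Eu := @run_recolor _ _ _ id (fun=> 0%N) (fun=> erefl) _ _ _ Eu.
rewrite Et map_cat /= in Eu => dD.
have := bracket_smooth hbracket (e := e) _ Eu.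
by rewrite size_map sz_t1 => /(_ _ dD) ->; case: (e).
Qed.

(** A diagram contains a cup, of class 0 after recolouring, so the new circle is tied to it. *)
Lemma kauffman_circle u v i c : oriented_diagram (u ++ v) ->
  oriented_diagram (u ++ [:: (i, Cup c); (i, Cap)] ++ v) ->
  kauffman (u ++ [:: (i, Cup c); (i, Cap)] ++ v) =
    - (varA ^+ 2 + varA ^- 2) * kauffman (u ++ v).
Proof.
move=> /[dup] /one_class_diagram duv duv0 /one_class_diagram duo; rewrite /kauffman.
have := @bracket_tied_circle _ hbracket (one_class u) (one_class v) i 0%N.
rewrite -one_class_cat /= addn0 => /(_ duv); rewrite !one_class_cat /= in duo *; apply => //.
rewrite -one_class_cat colors_recolor.
by case: (colors _) (colors_neq0 duv0) => // *; rewrite inE.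
Qed.

(** The factor of the bracket for a kink [Cross e]: one smoothing straightens the kink and the other
    adds a circle. *)
Definition kink (e : bool) : ZAc := if e then - varA ^- 3 else - varA ^+ 3.

Lemma kink_smooth e (k : ZAc) :
  (if e then varA * k + varA^-1 * (- (varA ^+ 2 + varA ^- 2) * k)
   else varA * (- (varA ^+ 2 + varA ^- 2) * k) + varA^-1 * k) = kink e * k.
Proof.
have AV := mulrV varA_unit; rewrite /kink -!exprVn.
move: (varA : ZAc) (varA^-1) AV => a b ab.
case: e.
- have -> : a * k + b * (- (a ^+ 2 + b ^+ 2) * k) = a * k - (a * b) * a * k - b ^+ 3 * k by ring.
  by rewrite ab; ring.
- have -> : a * (- (a ^+ 2 + b ^+ 2) * k) + b * k = - a ^+ 3 * k - (a * b) * b * k + b * k by ring.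
  by rewrite ab; ring.
Qed.

Lemma kauffman_R1Cup u v i c e :
  oriented_diagram (u ++ [:: (i, Cup c); (i, Cross e)] ++ v) ->
  oriented_diagram (u ++ [:: (i, Cup (~~ c))] ++ v) ->
  kauffman (u ++ [:: (i, Cup c); (i, Cross e)] ++ v) =
  kink e * kauffman (u ++ [:: (i, Cup (~~ c))] ++ v).
Proof.
move=> dD dD'; rewrite -kink_smooth.
have -> : u ++ [:: (i, Cup c); (i, Cross e)] ++ v = (u ++ [:: (i, Cup c)]) ++ (i, Cross e) :: v.
  by rewrite -catA.
rewrite (kauffman_smooth (~~ c)) -?catA //=.
have -> : kauffman (u ++ (i, Cup c) :: v) = kauffman (u ++ (i, Cup (~~ c)) :: v).
  by rewrite /kauffman !one_class_cat.
rewrite (@kauffman_circle u ((i, Cup (~~ c)) :: v)) //.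
have [t [t' [Eu Et Ev]]] := diagram_run dD'.
apply: (@diagram_replace u [:: (i, Cup (~~ c))]
  [:: (i, Cup c); (i, Cap); (i, Cup (~~ c))] v t t') dD' => //.
  rewrite -[[:: _; _; _]]/([:: (i, Cup c); (i, Cap)] ++ [:: (i, Cup (~~ c))]).
  have le_i_t : (i <= size t)%N.
    by move: Et => /=; case E: step => [t2|] //; have := step_size E; rewrite addn0 => /andP[].
  by rewrite run_cat run_circle.
by rewrite !size_cat /=; lia.
Qed.

Lemma kauffman_R1Cap u v i e :
  oriented_diagram (u ++ [:: (i, Cross e); (i, Cap)] ++ v) ->
  oriented_diagram (u ++ [:: (i, Cap)] ++ v) ->
  kauffman (u ++ [:: (i, Cross e); (i, Cap)] ++ v) =
  kink e * kauffman (u ++ [:: (i, Cap)] ++ v).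
Proof.
move=> dD dD'; rewrite -kink_smooth.
rewrite (@kauffman_smooth u ([:: (i, Cap)] ++ v) _ _ true) //=.
have -> : u ++ [:: (i, Cap), (i, Cup true), (i, Cap) & v] =
  (u ++ [:: (i, Cap)]) ++ [:: (i, Cup true); (i, Cap)] ++ v by rewrite -catA.
rewrite kauffman_circle -?catA //.
have [t [t' [Eu Et Ev]]] := diagram_run dD'.
apply: (@diagram_replace u [:: (i, Cap)]
  [:: (i, Cap); (i, Cup true); (i, Cap)] v t t') dD' => //.
  rewrite -[[:: _; _; _]]/([:: (i, Cap)] ++ [:: (i, Cup true); (i, Cap)]).
  rewrite run_cat Et; apply: run_circle.
  by move: Et => /=; case E: step => [t2|] //= -[<-]; have := step_size E => /=; lia.
by rewrite !size_cat /=; lia.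
Qed.

(** * The normalized bracket as a skein invariant *)

Definition jones_of D : ZAc := (- varA) ^ (- 3 * writhe D) * kauffman D.

Lemma oppA_unit : - varA \is a GRing.unit. Proof. by rewrite unitrN varA_unit. Qed.

Lemma writhe_factor w k : (- varA) ^ (- 3 * (w + k)) = (- varA) ^ (- 3 * w) * (- varA) ^ (- 3 * k).
Proof. by rewrite mulrDr exprzDr ?oppA_unit. Qed.

Lemma oppAX3 : (- varA) ^ (- 3 * 1) = - varA^-1 ^+ 3 /\ (- varA) ^ (- 3 * -1) = - varA ^+ 3.
Proof.
have oddX (x : ZAc) : (- x) ^+ 3 = - x ^+ 3 by ring.
split; last exact: oddX.
have -> : - 3 * 1 = - 3%:Z :> int by [].
by rewrite -exprnN oddX invrN exprVn.
Qed.

Lemma jones_of_writhe0 l r u v : writhe_drop 0 l r ->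
  oriented_diagram (u ++ l ++ v) -> kauffman (u ++ l ++ v) = kauffman (u ++ r ++ v) ->
  jones_of (u ++ l ++ v) = jones_of (u ++ r ++ v).
Proof. by rewrite /jones_of => w d ->; rewrite (writhe_drop_local w d) addr0. Qed.

(** The change of the writhe power of [- varA] is inverse to [kink e]. *)
Lemma jones_of_R1 l r u v e : writhe_drop (if e then -1 else 1) l r ->
  oriented_diagram (u ++ l ++ v) -> kauffman (u ++ l ++ v) = kink e * kauffman (u ++ r ++ v) ->
  jones_of (u ++ l ++ v) = jones_of (u ++ r ++ v).
Proof.
rewrite /jones_of => w d ->; rewrite (writhe_drop_local w d) writhe_factor.
rewrite mulrA -[_ * _ * kink e]mulrA; congr (_ * _); rewrite -[RHS]mulr1; congr (_ * _).
have [E1 E2] := oppAX3; rewrite /kink -exprVn.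
by case: (e); rewrite ?E1 ?E2 mulrNN -exprMn ?mulrV ?mulVr ?varA_unit ?expr1n.
Qed.

Lemma jones_of_skein : skein_invariant (varA^-1 ^+ 2) jones_of.
Proof.
split.
- move=> D D' + + m; case: m => u l r v m dD dD'.
  by apply: (jones_of_writhe0 (writhe_drop_planar m) dD); apply: kauffman_planar.
- move=> D D' + + m; case: m => u l r v [i c e|i e] dD dD'.
  + by apply: (jones_of_R1 (@writhe_drop_R1Cup i c e) dD); apply: kauffman_R1Cup.
  + by apply: (jones_of_R1 (@writhe_drop_R1Cap i e) dD); apply: kauffman_R1Cap.
- move=> D D' + + m; case: m => u l r v m dD dD'.
  by apply: (jones_of_writhe0 (writhe_drop_R2 m) dD); apply: kauffman_R2.
- move=> D D' + + m; case: m => u l r v m dD dD'.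
  by apply: (jones_of_writhe0 (writhe_drop_R3 m) dD); apply: kauffman_R3.
move=> u v s1 s2 d d' i dD Eu.
have run_X e := run_Cross_at s1 d d' s2 e; have run_0 := run_smoothing_at s1 d d' s2.
have dX e : oriented_diagram (u ++ (i, Cross e) :: v).
  apply: (@diagram_replace u [:: (i, Cross (d == d'))] [:: (i, Cross e)] v) dD.
  - exact: Eu. - exact: run_X. - exact: run_X. - by rewrite !size_cat /=; lia.
have w0 : writhe (u ++ oriented_smoothing i d d' ++ v) =
    writhe_from [::] u + writhe_from (s1 ++ [:: d', d & s2]) v.
  rewrite /writhe (writhe_from_cat _ Eu) (writhe_from_cat _ run_0); congr (_ + _).
  by rewrite /oriented_smoothing; case: ifP => _; rewrite /= !add0r.
have wX e : writhe (u ++ (i, Cross e) :: v) =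
    writhe (u ++ oriented_smoothing i d d' ++ v) + (if e == (d == d') then 1 else -1).
  rewrite w0 /writhe (writhe_from_cat _ Eu) -addrA; congr (_ + _); rewrite addrC.
  have := @writhe_from_cat _ _ [:: (i, Cross e)] v (run_X e) => ->; congr (_ + _).
  rewrite /= addr0 /crossing_sign !nth_cat ltnn subnn ltnNge leqnSn /=.
  by rewrite subSn // subnn.
pose k0 := kauffman (u ++ oriented_smoothing i d d' ++ v).
(* The oriented smoothing is the A-smoothing of the positive crossing and the B-smoothing of the
   negative one; [k1] is the bracket of the other smoothing. *)
have [k1 [Kp Km]] : exists k1,
    kauffman (u ++ (i, Cross (d == d')) :: v) = varA * k0 + varA^-1 * k1 /\
    kauffman (u ++ (i, Cross (d != d')) :: v) = varA * k1 + varA^-1 * k0.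
  rewrite !(kauffman_smooth d' (dX _)) /k0 /oriented_smoothing; case: ifP => _ /=.
  - by exists (kauffman (u ++ [:: (i, Cap), (i, Cup d') & v])).
  - by exists (kauffman (u ++ v)).
rewrite /jones_of !wX eqxx Kp Km -/k0.
have -> : ((d != d') == (d == d')) = false by case: (d == d').
have [E1 E2] := oppAX3; rewrite !writhe_factor E1 E2.
set T := (- varA) ^ _; have AV := mulrV varA_unit.
rewrite -!exprM -!exprVn invrK.
move: (varA : ZAc) (varA^-1) k0 k1 T AV {Kp Km E1 E2} => a b k0 k1 T ab.
(* The two terms in [k1] cancel, which is what the writhe factors achieve. *)
have -> : a ^+ (2 * 2) * (T * (- b ^+ 3) * (a * k0 + b * k1)) -
  b ^+ (2 * 2) * (T * (- a ^+ 3) * (a * k1 + b * k0)) =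
  (a * b) ^+ 3 * (b ^+ 2 - a ^+ 2) * T * k0 by ring.
by rewrite ab expr1n mul1r mulrA.
Qed.

End OneClass.

(** * Comparison in [Zqc] *)

Lemma skein_invariant_rmorph (K L : comUnitRingType) (h : {rmorphism K -> L}) s f :
  s \is a GRing.unit -> skein_invariant s f -> skein_invariant (h s) (h \o f).
Proof.
move=> Us [pl r1 r2 r3 sk]; split.
- by move=> D D' dD dD' m /=; rewrite (pl D D').
- by move=> D D' dD dD' m /=; rewrite (r1 D D').
- by move=> D D' dD dD' m /=; rewrite (r2 D D').
- by move=> D D' dD dD' m /=; rewrite (r3 D D').
move=> u v s1 s2 d d' i dD Eu /=; rewrite -rmorphXn -!rmorphV ?unitrX //.
by rewrite -!rmorphM -!rmorphB -!rmorphM (sk _ _ s1 s2).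
Qed.

Lemma jones_skein_invariant V : is_jones V -> skein_invariant sqrt_t V.
Proof.
case=> iso r1 r2 r3 _ sk; split=> //.
by move=> D D' dD dD' m; apply: iso => //; left.
Qed.

Theorem corollary1
  (bracket : word nat -> ZAc) (hbracket : is_double_bracket bracket)
  (V : word bool -> Zs) (hV : is_jones V)
  (D : word (bool * nat)) (hD : oriented_tied_diagram D) (hties : all_tied D) :
  subst_A (calJ bracket D) = subst_s (V (forget_ties D)).
Proof.
have dD : oriented_diagram (forget_ties D) by apply: diagram_recolor hD => -[].
have -> : calJ bracket D = jones_of bracket (forget_ties D).
  rewrite /calJ /jones_of; congr (_ * _); rewrite /kauffman /one_class recolor_comp.
  have dO : tied_diagram (forget_orientation D) by apply: diagram_recolor hD => -[].
  (* All cups carry one class name, so renaming it to 0 is injective on the names that occur. *)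
  rewrite -(@bracket_rename _ hbracket (forget_orientation D) (fun=> 0%N)) ?recolor_comp //.
  move=> x y; rewrite /all_tied in hties.
  case: (colors _) hties => // z s /all_pred1P Ez.
  rewrite !inE {}Ez !mem_nseq.
  by move=> /orP[/eqP->|/andP[_ /eqP->]] /orP[/eqP->|/andP[_ /eqP->]].
(* Both skein parameters, [varA^-1 ^+ 2] on one side and [sqrt_t] on the other, become the square of
   [root4_t]. *)
have sX : subst_A (varA^-1 ^+ 2) = root4_t ^+ 2.
  by rewrite rmorphXn rmorphV ?varA_unit //= subst_A_var invrK.
have := @skein_invariant_rmorph _ _ subst_A _ _ _ (jones_of_skein hbracket).
rewrite /= sX unitrX ?unitrV ?varA_unit // => /(_ isT) J_skein.
have := @skein_invariant_rmorph _ _ subst_s _ _ (laurentX_unit _) (jones_skein_invariant hV).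
rewrite /= subst_s_sqrt => V_skein.
apply: (skein_unique J_skein V_skein root4_sqr_unit root4_sqr_regular _ dD) => d /=.
rewrite (jones_unknot hV) rmorph1 /jones_of /kauffman -[one_class _]/(circle 0%N).
rewrite (bracket_circle hbracket) mulr1.
by rewrite rmorph1.
Qed.
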